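(* Let $\ell=2n-1$ or $\ell=2n$ with $n\in\mathbb Z_{\ge2}$, and let $1\le j\le n-1$. Let $\widehat P\in\widehat{\mathcal{MV}}$ and $P=\Phi^{-1}(\widehat P)\in\mathcal{MV}^\omega$. Let $\mu_\bullet=(\mu_w)_{w\in W}$ and $\mu'_\bullet=(\mu'_w)_{w\in W}$ be the GGMS data of $P$ and of $f_j^\omega P$, respectively, let $c=M_{\Lambda_j}-M_{s_j\Lambda_j}-1$ where $(M_\gamma)_{\gamma\in\Gamma}=D(\mu_\bullet)$, and put $\sigma(h)=s_j\cdot h+ch_j$, $\tau(h)=s_{\omega(j)}\cdot h+ch_{\omega(j)}$ for $h\in\mathfrak h$. Then $\widetilde P(\mu'_\bullet)$ is the smallest convex polytope (with respect to inclusion) among the polytopes $\widetilde P=\widetilde P(\mu''_\bullet)\in\widetilde{\mathcal P}$ with GGMS datum $\mu''_\bullet=(\mu''_w)_{w\in W}\in\mathcal V^\omega$ satisfying the following conditions (i)–(v) (that is, $\widetilde P(\mu'_\bullet)$ itself satisfies them with $\mu''_\bullet=\mu'_\bullet$, and it is contained in every such $\widetilde P$): (i) If $w\in W^\omega_-$, then $\mu''_w=\mu_w$. (ii) $\mu''_e=\mu_e-h_j^\omega$. (iii) If $w\in W^\omega_+$, then $\mu_w\in\widetilde P$. (iv) If $w\in W$ is such that $s_jw<w$ and $\langle\alpha_j,\mu_w\rangle\ge c$, then $\sigma(\mu_w)\in\widetilde P$. Also, if $w\in W$ is such that $s_{\omega(j)}w<w$ and $\langle\alpha_{\omega(j)},\mu_w\rangle\ge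 c$, then $\tau(\mu_w)\in\widetilde P$. (v) If $w\in W^\omega_-$ is such that $\langle\alpha_j,\mu_w\rangle\ge c$, then $\sigma\tau(\mu_w)\in\widetilde P$.
   Context: **Type $A$ data.** Let $\ell=2n-1$ or $\ell=2n$ with $n\ge2$, $I=\{1,\dots,\ell\}$, and let $\mathfrak g$ be the simple Lie algebra over $\mathbb C$ of type $A_\ell$ with Cartan subalgebra $\mathfrak h$, simple coroots $h_j\in\mathfrak h$, simple roots $\alpha_j\in\mathfrak h^*$, fundamental weights $\Lambda_j\in\mathfrak h^*$ ($j\in I$), Cartan matrix $a_{ij}=\langle\alpha_j,h_i\rangle$, and Weyl group $W=\langle s_i\mid i\in I\rangle$ with unit $e$ and longest element $w_0$; $>$ is the (weak) Bruhat order ($ws_i>w$ iff right multiplication by $s_i$ raises the length; similarly on the left). Put $\mathfrak h_{\mathbb R}=\bigoplus_j\mathbb R h_j$ and $\Gamma=\{w\Lambda_i\mid w\in W,i\in I\}$. For $w\in W$ and $h,h'\in\mathfrak h_{\mathbb R}$ write $h\ge_w h'$ if $w^{-1}h-w^{-1}h'\in\sum_j\mathbb R_{\ge0}h_j$. **Pseudo-Weyl and MV polytopes.** $\mathcal V$ is the set of families $\mu_\bullet=(\mu_w)_{w\in W}$ in $\mathfrak h_{\mathbb R}$ with $\mu_{w'}\ge_w\mu_w$ for all $w,w'\in W$ and $\mu_{w_0}=0$. For $\mu_\bullet\in\mathcal V$ let $P(\mu_\bullet)=\{h\in\mathfrak h_{\mathbb R}\mid h\ge_w\mu_w\ \forall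 w\in W\}$; it determines $\mu_\bullet$, called its GGMS datum. Put $D(\mu_\bullet)=(M_\gamma)_{\gamma\in\Gamma}$ with $M_{w\Lambda_i}=\langle w\Lambda_i,\mu_w\rangle$ (well defined). $P(\mu_\bullet)$ is an MV polytope for $\mathfrak g$ if all $M_\gamma\in\mathbb Z$ and, for all $w\in W$ and $i\ne j$ in $I$ with $ws_i>w$, $ws_j>w$, $a_{ij}=a_{ji}=-1$, $$M_{ws_i\Lambda_i}+M_{ws_j\Lambda_j}=\min\bigl(M_{w\Lambda_i}+M_{ws_is_j\Lambda_j},\ M_{ws_js_i\Lambda_i}+M_{w\Lambda_j}\bigr).$$ $\mathcal{MV}$ is the set of MV polytopes for $\mathfrak g$. **Kashiwara operators on $\mathcal{MV}$.** For $j\in I$ and $P=P(\mu_\bullet)\in\mathcal{MV}$, $f_jP$ is the unique MV polytope $P(\mu'_\bullet)\in\mathcal{MV}$ with $\mu'_e=\mu_e-h_j$ and $\mu'_w=\mu_w$ for all $w\in W$ with $s_jw<w$ (existence and uniqueness are known, due to Kamnitzer). **Diagram automorphism.** $\omega:I\to I$, $\omega(j)=\ell-j+1$; $\omega$ also denotes the induced involutions of $\mathfrak g$ (permuting the Chevalley generators), of $\mathfrak h$ ($h_j\mapsto h_{\omega(j)}$) and of $W$ ($s_i\mapsto s_{\omega(i)}$); $\mathfrak g^\omega,\mathfrak h^\omega,W^\omega$ are the fixed points. For $\mu_\bullet\in\mathcal V$, $\omega(\mu_\bullet)=(\omega(\mu_{\omega(w)}))_{w\in W}\in\mathcal V$;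 $\mathcal V^\omega=\{\mu_\bullet\in\mathcal V\mid\omega(\mu_\bullet)=\mu_\bullet\}$. $\mathcal{MV}^\omega$ is the set of $P(\mu_\bullet)\in\mathcal{MV}$ with $\mu_\bullet\in\mathcal V^\omega$, equivalently with $\omega(P)=P$. **Operators $f_j^\omega$, elements $s_j^\omega$, $h_j^\omega$** ($j\in\widehat I=\{1,\dots,n\}$). For $1\le j\le n-1$: $f_j^\omega=f_jf_{\omega(j)}$, $s_j^\omega=s_js_{\omega(j)}$, $h_j^\omega=h_j+h_{\omega(j)}$. For $j=n$: if $\ell=2n-1$, $f_n^\omega=f_n$, $s_n^\omega=s_n$, $h_n^\omega=h_n$; if $\ell=2n$, $f_n^\omega=f_nf_{\omega(n)}^2f_n$, $s_n^\omega=s_ns_{\omega(n)}s_n$, $h_n^\omega=2(h_n+h_{\omega(n)})$. The operators $f_j^\omega$ preserve $\mathcal{MV}^\omega$. For the fixed $j$, $W^\omega_+=\{w\in W^\omega\mid s_j^\omega w>w\}$ and $W^\omega_-=\{w\in W^\omega\mid s_j^\omega w<w\}$. **Polytopes $\widetilde P$.** For $\mu_\bullet\in\mathcal V^\omega$, $\widetilde P(\mu_\bullet)=\{h\in\mathfrak h_{\mathbb R}\mid h\ge_w\mu_w\text{ for all }w\in W^\omega\}$, a convex polytope in $\mathfrak h_{\mathbb R}$; $\mu_\bullet$ is called its GGMS datum. $\widetilde{\mathcal P}=\{\widetilde P(\mu_\bullet)\mid\mu_\bullet\in\mathcal V^\omega\}$. **The fixed point algebra and $\widehat{\mathcal{MV}}$.**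 $\mathfrak g^\omega$ is simple of type $C_n$ if $\ell=2n-1$ and $B_n$ if $\ell=2n$, with Cartan subalgebra $\mathfrak h^\omega$ and simple coroots $h_j^\omega$, $j\in\widehat I$. Let $\widehat A=(\widehat a_{ij})$ be its Cartan matrix ($\widehat a_{ij}$ is the value of the $j$-th simple root on $h_i^\omega$), $\widehat\Lambda_i\in(\mathfrak h^\omega)^*$ its fundamental weights, $\widehat W=\langle\widehat s_i\mid i\in\widehat I\rangle$ its Weyl group with unit $\widehat e$ and longest element $\widehat w_0$. There is a group isomorphism $\Theta:\widehat W\to W^\omega$ with $\Theta(\widehat s_i)=s_i^\omega$. On $\mathfrak h^\omega\cap\mathfrak h_{\mathbb R}$, $h\ge_{\widehat w}h'$ means $\widehat w^{-1}h-\widehat w^{-1}h'\in\sum_{j\in\widehat I}\mathbb R_{\ge0}h_j^\omega$. $\widehat{\mathcal V}$ is the set of families $(\widehat\mu_{\widehat w})_{\widehat w\in\widehat W}$ in $\mathfrak h^\omega\cap\mathfrak h_{\mathbb R}$ with $\widehat\mu_{\widehat w'}\ge_{\widehat w}\widehat\mu_{\widehat w}$ for all $\widehat w,\widehat w'$ and $\widehat\mu_{\widehat w_0}=0$; $\widehat P(\widehat\mu_\bullet)=\{h\in\mathfrak h^\omega\cap\mathfrak h_{\mathbb R}\mid h\ge_{\widehat w}\widehat\mu_{\widehat w}\ \forall\widehat w\}$; $\widehat M_{\widehat w\widehat\Lambda_i}=\langle\widehat w\widehat\Lambda_i,\widehat\mu_{\widehat w}\rangle$. $\widehat P(\widehat\mu_\bullet)$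 is an MV polytope for $\mathfrak g^\omega$ (an element of $\widehat{\mathcal{MV}}$) if all $\widehat M_{\widehat\gamma}\in\mathbb Z$ and, for all $w\in\widehat W$ and $i\ne j$ in $\widehat I$ with $w\widehat s_i>w$, $w\widehat s_j>w$ (writing $s,\Lambda,M,a$ for $\widehat s,\widehat\Lambda,\widehat M,\widehat a$), either $a_{ij}=a_{ji}=0$, or (1) $a_{ij}=a_{ji}=-1$ and $M_{ws_i\Lambda_i}+M_{ws_j\Lambda_j}=\min(M_{w\Lambda_i}+M_{ws_is_j\Lambda_j},\ M_{ws_js_i\Lambda_i}+M_{w\Lambda_j})$; or (2) $a_{ij}=-1,a_{ji}=-2$ and $M_{ws_j\Lambda_j}+M_{ws_is_j\Lambda_j}+M_{ws_i\Lambda_i}=\min(2M_{ws_is_j\Lambda_j}+M_{w\Lambda_i},\ 2M_{w\Lambda_j}+M_{ws_is_js_i\Lambda_i},\ M_{w\Lambda_j}+M_{ws_js_is_j\Lambda_j}+M_{ws_i\Lambda_i})$, $M_{ws_js_i\Lambda_i}+2M_{ws_is_j\Lambda_j}+M_{ws_i\Lambda_i}=\min(2M_{w\Lambda_j}+2M_{ws_is_js_i\Lambda_i},\ 2M_{ws_js_is_j\Lambda_j}+2M_{ws_i\Lambda_i},\ M_{ws_is_js_i\Lambda_i}+2M_{ws_is_j\Lambda_j}+M_{w\Lambda_i})$; or (3) $a_{ij}=-2,a_{ji}=-1$ and $M_{ws_js_i\Lambda_i}+M_{ws_i\Lambda_i}+M_{ws_is_j\Lambda_j}=\min(2M_{ws_i\Lambda_i}+M_{ws_js_is_j\Lambda_j},\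 2M_{ws_is_js_i\Lambda_i}+M_{w\Lambda_j},\ M_{ws_is_js_i\Lambda_i}+M_{w\Lambda_i}+M_{ws_is_j\Lambda_j})$, $M_{ws_j\Lambda_j}+2M_{ws_i\Lambda_i}+M_{ws_is_j\Lambda_j}=\min(2M_{ws_is_js_i\Lambda_i}+2M_{w\Lambda_j},\ 2M_{w\Lambda_i}+2M_{ws_is_j\Lambda_j},\ M_{w\Lambda_j}+2M_{ws_i\Lambda_i}+M_{ws_js_is_j\Lambda_j})$. **The map $\Phi$.** $\Phi:\mathcal{MV}^\omega\to\widehat{\mathcal{MV}}$, $\Phi(P(\mu_\bullet))=\widehat P\bigl((\mu_{\Theta(\widehat w)})_{\widehat w\in\widehat W}\bigr)$, is a bijection. With $\widehat f_j$ the lowering Kashiwara operator on $\widehat{\mathcal{MV}}$ (characterized by $\widehat\mu'_{\widehat e}=\widehat\mu_{\widehat e}-h_j^\omega$ and $\widehat\mu'_{\widehat w}=\widehat\mu_{\widehat w}$ whenever $\widehat s_j\widehat w<\widehat w$), one has $\widehat f_j\widehat P=\Phi(f_j^\omega P)=\widetilde P(\mu'_\bullet)\cap\mathfrak h^\omega$ for $\widehat P=\Phi(P)$ and $\mu'_\bullet$ the GGMS datum of $f_j^\omega P$. *)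

(* Defs.v *)
From HB Require Import structures.
From mathcomp Require Import all_boot all_order all_algebra.
From mathcomp Require Import zify.
From mathcomp Require Import boolp classical_sets reals.

Set Implicit Arguments.
Unset Strict Implicit.
Unset Printing Implicit Defensive.

Import Order.TTheory GRing.Theory Num.Theory.
Local Open Scope classical_set_scope.
Local Open Scope ring_scope.

(** Generalized Cartan matrices, with the convention a_ij = <alpha_j, h_i>. *)
Record gcm (r : nat) := Gcm {
  gcm_mx :> 'M[int]_r;
  gcm_diag : forall i, gcm_mx i i = 2;
  gcm_le0 : forall i j, i != j -> gcm_mx i j <= 0;
  gcm_eq0 : forall i j, gcm_mx i j = 0 -> gcm_mx j i = 0 }.

(** The real Cartan subalgebra is 'cV[R]_r, in the basis of the simple coroots
    h_i; its dual is 'rV[R]_r, in the dual basis, which is that of the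
    fundamental weights.  The Weyl group is the group of matrices generated by
    the simple reflections, acting on 'cV[R]_r on the left. *)
Section RootDatum.
Variables (R : realType) (r : nat) (A : gcm r).

Definition coroot (i : 'I_r) : 'cV[R]_r := delta_mx i 0.
Definition sroot (j : 'I_r) : 'rV[R]_r := \row_i (A i j)%:~R.
Definition fundw (i : 'I_r) : 'rV[R]_r := delta_mx 0 i.
Definition pairing (lambda : 'rV[R]_r) (h : 'cV[R]_r) : R := (lambda *m h) 0 0.

Lemma pairing_sroot_coroot i j : pairing (sroot j) (coroot i) = (A i j)%:~R.
Proof. by rewrite /pairing /sroot /coroot -colE !mxE. Qed.

Lemma pairing_fundw_coroot i j : pairing (fundw j) (coroot i) = (i == j)%:R.
Proof. by rewrite /pairing /fundw /coroot -colE !mxE eqxx. Qed.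

Definition refl_mx (i : 'I_r) : 'M[R]_r := 1%:M - coroot i *m sroot i.

Lemma refl_mxE i h : refl_mx i *m h = h - pairing (sroot i) h *: coroot i.
Proof.
by rewrite mulmxBl mul1mx -mulmxA [sroot i *m h]mx11_scalar mul_mx_scalar.
Qed.

Lemma refl_mxK i : refl_mx i *m refl_mx i = 1%:M.
Proof.
rewrite {1}/refl_mx mulmxBl mul1mx -mulmxA {2}/refl_mx mulmxBr mulmx1.
rewrite [sroot i *m (_ *m _)]mulmxA [sroot i *m coroot i]mx11_scalar.
rewrite -/(pairing _ _) pairing_sroot_coroot gcm_diag mul_scalar_mx.
rewrite [_ *: _]scaler_nat mulr2n opprD addrA subrr sub0r mulmxN opprK.
by rewrite /refl_mx subrK.
Qed.

Definition word_mx (u : seq 'I_r) : 'M[R]_r :=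
  foldr (fun i m => refl_mx i *m m) 1%:M u.

Lemma word_mx_cat u v : word_mx (u ++ v) = word_mx u *m word_mx v.
Proof. by elim: u => [|i u /= ->]; rewrite ?mul1mx ?mulmxA. Qed.

Lemma word_mx_rev u : word_mx (rev u) *m word_mx u = 1%:M.
Proof.
elim: u => [|i u IHu]; first exact: mulmx1.
rewrite rev_cons -cats1 word_mx_cat /= mulmx1 -mulmxA [refl_mx i *m _]mulmxA.
by rewrite refl_mxK mul1mx.
Qed.

Definition in_weyl (m : 'M[R]_r) : bool := `[< exists u, m = word_mx u >].

Record weyl := Weyl { weyl_mx :> 'M[R]_r; weyl_mxP : in_weyl weyl_mx }.

HB.instance Definition _ := [isSub for weyl_mx].
HB.instance Definition _ := [Choice of weyl by <:].

Fact word_in_weyl u : in_weyl (word_mx u).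
Proof. by apply/asboolP; exists u. Qed.

Fact weyl1_subproof : in_weyl 1%:M.
Proof. exact: (word_in_weyl [::]). Qed.

Fact weylM_subproof (v w : weyl) : in_weyl (v *m w).
Proof.
have [/asboolP[a ->] /asboolP[b ->]] := (weyl_mxP v, weyl_mxP w).
by rewrite -word_mx_cat word_in_weyl.
Qed.

Fact weylV_subproof (w : weyl) : in_weyl (invmx w).
Proof.
have /asboolP[a ->] := weyl_mxP w.
have aV := word_mx_rev a; have [_ aU] := mulmx1_unit aV.
by rewrite -[invmx _]mul1mx -aV mulmxK // word_in_weyl.
Qed.

Definition weyl1 := Weyl weyl1_subproof.
Definition weylM v w := Weyl (weylM_subproof v w).
Definition weylV w := Weyl (weylV_subproof w).

Fact weylMA : associative weylM.
Proof. by move=> u v w; apply: val_inj; rewrite /= mulmxA. Qed.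
Fact weyl1M : left_id weyl1 weylM.
Proof. by move=> w; apply: val_inj; rewrite /= mul1mx. Qed.
Fact weylM1 : right_id weyl1 weylM.
Proof. by move=> w; apply: val_inj; rewrite /= mulmx1. Qed.
Fact weyl_unit (w : weyl) : weyl_mx w \in unitmx.
Proof.
have /asboolP[a ->] := weyl_mxP w.
by have [] := mulmx1_unit (word_mx_rev a).
Qed.
Fact weylVM : left_inverse weyl1 weylV weylM.
Proof. by move=> w; apply: val_inj; rewrite /= mulVmx ?weyl_unit. Qed.
Fact weylMV : right_inverse weyl1 weylV weylM.
Proof. by move=> w; apply: val_inj; rewrite /= mulmxV ?weyl_unit. Qed.

HB.instance Definition _ :=
  isGroup.Build weyl weylMA weyl1M weylM1 weylVM weylMV.

Fact refl_in_weyl i : in_weyl (refl_mx i).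
Proof. by apply/asboolP; exists [:: i]; rewrite /= mulmx1. Qed.

Definition srefl (i : 'I_r) : weyl := Weyl (refl_in_weyl i).
Definition word (u : seq 'I_r) : weyl := (\prod_(i <- u) srefl i)%g.

Fact weyl_word_ex (w : weyl) :
  exists k, [exists u : k.-tuple 'I_r, w == word u].
Proof.
have /asboolP[u Eu] := weyl_mxP w; exists (size u).
apply/existsP; exists (in_tuple u); apply/eqP/val_inj; rewrite /= Eu /word.
by elim: u {w Eu} => [|i u IHu]; rewrite ?big_nil // big_cons /= IHu.
Qed.

Definition len (w : weyl) : nat := ex_minn (weyl_word_ex w).

Definition longest (w : weyl) : Prop := forall v, (len v <= len w)%N.

(** Right and left weak orders; for v = w s_i, resp. v = s_i w, they say that
    the multiplication by s_i raises the length. *)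
Definition rweak_lt (w v : weyl) : Prop :=
  exists x, [/\ x != 1%g, v = (w * x)%g & len v = (len w + len x)%N].
Definition lweak_lt (w v : weyl) : Prop :=
  exists x, [/\ x != 1%g, v = (x * w)%g & len v = (len x + len w)%N].

Definition weyl_ge (w : weyl) (h h' : 'cV[R]_r) : Prop :=
  forall i, 0 <= ((w^-1)%g *m h - (w^-1)%g *m h') i 0.

Definition gfamily := weyl -> 'cV[R]_r.

Definition pseudoWeyl (mu : gfamily) : Prop :=
  (forall w w', weyl_ge w (mu w') (mu w)) /\ (forall w, longest w -> mu w = 0).

Definition polytope (mu : gfamily) : set 'cV[R]_r :=
  [set h | forall w, weyl_ge w h (mu w)].

Definition GGMS (P : set 'cV[R]_r) (mu : gfamily) : Prop :=
  pseudoWeyl mu /\ P = polytope mu.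

Definition weight_act (w : weyl) (lambda : 'rV[R]_r) : 'rV[R]_r :=
  lambda *m (w^-1)%g.

(** [BZ mu w i] is the component M_(w Lambda_i) of D(mu). *)
Definition BZ (mu : gfamily) (w : weyl) (i : 'I_r) : R :=
  pairing (weight_act w (fundw i)) (mu w).

(** The last two clauses are vacuous when A is simply laced. *)
Definition tropical_Plucker (mu : gfamily) : Prop :=
  forall (w : weyl) (i j : 'I_r), i != j ->
    rweak_lt w (w * srefl i)%g -> rweak_lt w (w * srefl j)%g ->
  let M u k := BZ mu (w * word u)%g k in
  [/\ (A i j = -1 -> A j i = -1 ->
        M [:: i] i + M [:: j] j =
          Num.min (M [::] i + M [:: i; j] j) (M [:: j; i] i + M [::] j)),
      (A i j = -1 -> A j i = -2 ->
        M [:: j] j + M [:: i; j] j + M [:: i] i =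
          Num.min (2 * M [:: i; j] j + M [::] i)
         (Num.min (2 * M [::] j + M [:: i; j; i] i)
                  (M [::] j + M [:: j; i; j] j + M [:: i] i))
        /\
        M [:: j; i] i + 2 * M [:: i; j] j + M [:: i] i =
          Num.min (2 * M [::] j + 2 * M [:: i; j; i] i)
         (Num.min (2 * M [:: j; i; j] j + 2 * M [:: i] i)
                  (M [:: i; j; i] i + 2 * M [:: i; j] j + M [::] i)))
    & (A i j = -2 -> A j i = -1 ->
        M [:: j; i] i + M [:: i] i + M [:: i; j] j =
          Num.min (2 * M [:: i] i + M [:: j; i; j] j)
         (Num.min (2 * M [:: i; j; i] i + M [::] j)
                  (M [:: i; j; i] i + M [::] i + M [:: i; j] j))
        /\
        M [:: j] j + 2 * M [:: i] i + M [:: i; j] j =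
          Num.min (2 * M [:: i; j; i] i + 2 * M [::] j)
         (Num.min (2 * M [::] i + 2 * M [:: i; j] j)
                  (M [::] j + 2 * M [:: i] i + M [:: j; i; j] j)))].

Definition MV : set (set 'cV[R]_r) :=
  [set P | exists mu, [/\ GGMS P mu,
     (forall w i, BZ mu w i \is a Num.int) & tropical_Plucker mu]].

(** The graph of the lowering operator f_j, as a partial map on polytopes. *)
Definition kashiwara (j : 'I_r) (P P' : set 'cV[R]_r) : Prop :=
  [/\ MV P, MV P' & exists mu mu', [/\ GGMS P mu, GGMS P' mu',
     mu' 1%g = mu 1%g - coroot j &
     forall w, lweak_lt (srefl j * w)%g w -> mu' w = mu w]].

End RootDatum.

Arguments coroot R {r} i.
Arguments srefl R {r} A i.

(** Indices are numbered from 0, so that the diagram automorphism is [rev_ord]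
    and i < n - 1 reads [i.+1 < n]. *)

(** The rank is 2n - 1 if [ev] is false, and 2n if it is true. *)
Definition ell (n : nat) (ev : bool) : nat := if ev then n.*2 else n.*2.-1.

Definition typeA_mx (l : nat) : 'M[int]_l :=
  \matrix_(i, j) (if i == j then 2
                  else if (i.+1 == j) || (j.+1 == i) then -1 else 0).

Fact typeA_diag l i : typeA_mx l i i = 2.
Proof. by rewrite mxE eqxx. Qed.
Fact typeA_le0 l i j : i != j -> typeA_mx l i j <= 0.
Proof. by move=> /negPf ij; rewrite mxE ij; case: ifP. Qed.
Fact typeA_eq0 l i j : typeA_mx l i j = 0 -> typeA_mx l j i = 0.
Proof. by rewrite !mxE eq_sym orbC. Qed.

Definition typeA l : gcm l :=
  Gcm (@typeA_diag l) (@typeA_le0 l) (@typeA_eq0 l).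

Lemma typeA_rev l i j : typeA l (rev_ord i) (rev_ord j) = typeA l i j.
Proof.
rewrite !mxE (inj_eq rev_ord_inj) /=; case: eqP => // _.
have [il jl] := (ltn_ord i, ltn_ord j).
by congr (if _ then _ else _); lia.
Qed.

(** Type C_n if [ev] is false, B_n if it is true. *)
Definition typeBC_mx (n : nat) (ev : bool) : 'M[int]_n :=
  \matrix_(i, j)
    (if i == j then 2
     else if i.+1 == j then (if (j.+1 == n) && ~~ ev then -2 else -1)
     else if j.+1 == i then (if (i.+1 == n) && ev then -2 else -1)
     else 0).

Fact typeBC_diag n ev i : typeBC_mx n ev i i = 2.
Proof. by rewrite mxE eqxx. Qed.
Fact typeBC_le0 n ev i j : i != j -> typeBC_mx n ev i j <= 0.
Proof. by move=> /negPf ij; rewrite mxE ij; do ![case: ifP]. Qed.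
Fact typeBC_eq0 n ev i j : typeBC_mx n ev i j = 0 -> typeBC_mx n ev j i = 0.
Proof.
rewrite !mxE eq_sym; case: eqP => // _.
case: (@eqP _ i.+1 j) => ij; first by case: ifP.
by case: (@eqP _ j.+1 i) => // ji; case: ifP.
Qed.

Definition typeBC n ev : gcm n :=
  Gcm (@typeBC_diag n ev) (@typeBC_le0 n ev) (@typeBC_eq0 n ev).

Section Folding.
Variables (R : realType) (n : nat) (ev : bool).

Let l := ell n ev.
Let A := typeA l.
Let s := srefl R A.
Let h_ := @coroot R l.
Let om := @rev_ord l.

Fact leq_ell : (n <= ell n ev)%N.
Proof. by rewrite /ell; case: ev; lia. Qed.

Definition emb (i : 'I_n) : 'I_(ell n ev) := widen_ord leq_ell i.

Definition omegah (h : 'cV[R]_(ell n ev)) : 'cV[R]_(ell n ev) :=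
  \col_i h (rev_ord i) 0.

Lemma omegah_coroot i : omegah (coroot R i) = coroot R (rev_ord i).
Proof.
by apply/colP=> k; rewrite !mxE -(inj_eq rev_ord_inj) rev_ordK.
Qed.

Definition omega_mx (m : 'M[R]_(ell n ev)) : 'M[R]_(ell n ev) :=
  \matrix_(i, k) m (rev_ord i) (rev_ord k).

Lemma omega_mxM m m' : omega_mx (m *m m') = omega_mx m *m omega_mx m'.
Proof.
apply/matrixP=> i k; rewrite !mxE (reindex_inj rev_ord_inj) /=.
by apply: eq_bigr => p _; rewrite !mxE.
Qed.

Lemma omega_mx_refl i : omega_mx (refl_mx R A i) = refl_mx R A (rev_ord i).
Proof.
apply/matrixP=> p q; rewrite !mxE (inj_eq rev_ord_inj) !big_ord1 !mxE.
rewrite -!/(typeA_mx l) /= (can2_eq rev_ordK rev_ordK).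
by have := typeA_rev q (rev_ord i); rewrite rev_ordK !mxE => ->.
Qed.

Fact omegaW_subproof (w : weyl R (typeA (ell n ev))) :
  in_weyl (typeA (ell n ev)) (omega_mx w).
Proof.
have /asboolP[u ->] := weyl_mxP w; apply/asboolP; exists (map om u).
elim: u => [|i u IHu] /=; last by rewrite omega_mxM omega_mx_refl IHu.
by apply/matrixP=> i k; rewrite !mxE (inj_eq rev_ord_inj).
Qed.

(** The automorphism s_i |-> s_(omega i) of W, realized as the conjugation by
    [omegah]. *)
Definition omegaW (w : weyl R (typeA (ell n ev))) := Weyl (omegaW_subproof w).

Lemma omegaW_refl i : omegaW (srefl R A i) = srefl R A (rev_ord i).
Proof. by apply: val_inj; rewrite /= omega_mx_refl. Qed.

Lemma omegaWM v w : omegaW (v * w)%g = (omegaW v * omegaW w)%g.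
Proof. by apply: val_inj; rewrite /= omega_mxM. Qed.

Lemma omegaW_act w h : omegaW w *m omegah h = omegah (w *m h).
Proof.
apply/colP=> k; rewrite !mxE [RHS](reindex_inj rev_ord_inj) /=.
by apply: eq_bigr => p _; rewrite !mxE.
Qed.

Definition Womega : set (weyl R (typeA (ell n ev))) := [set w | omegaW w = w].

Definition Vomega : set (gfamily R (typeA (ell n ev))) :=
  [set mu | pseudoWeyl mu /\ (fun w => omegah (mu (omegaW w))) = mu].

Definition MVomega : set (set 'cV[R]_(ell n ev)) :=
  [set P | MV (typeA (ell n ev)) P /\ exists2 mu, GGMS P mu & Vomega mu].

Definition coroot_omega (i : 'I_n) : 'cV[R]_(ell n ev) :=
  let k := emb i in
  if (i.+1 < n)%N then h_ k + h_ (om k)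
  else if ev then 2 *: (h_ k + h_ (om k)) else h_ k.

Definition refl_omega (i : 'I_n) : weyl R (typeA (ell n ev)) :=
  let k := emb i in
  (if (i.+1 < n)%N then s k * s (om k)
   else if ev then s k * s (om k) * s k else s k)%g.

Definition kashiwara_omega (i : 'I_n) (P P' : set 'cV[R]_(ell n ev)) : Prop :=
  let k := emb i in
  let f := kashiwara (typeA (ell n ev)) in
  if (i.+1 < n)%N then exists Q, f (om k) P Q /\ f k Q P'
  else if ev then
    exists Q1 Q2 Q3, [/\ f k P Q1, f (om k) Q1 Q2, f (om k) Q2 Q3 & f k Q3 P']
  else f k P P'.

(** The simple roots of the fixed point algebra are the restrictions of the
    alpha_j with j <= n. *)
Lemma typeBC_root_coroot i j :
  (typeBC n ev i j)%:~R = pairing (sroot R A (emb j)) (coroot_omega i).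
Proof.
have pD (a : 'rV[R]_(ell n ev)) x y :
    pairing a (x + y) = pairing a x + pairing a y.
  by rewrite /pairing mulmxDr mxE.
have pZ (a : 'rV[R]_(ell n ev)) b x : pairing a (b *: x) = b * pairing a x.
  by rewrite /pairing -scalemxAr mxE.
have {pD pZ} -> : pairing (sroot R A (emb j)) (coroot_omega i) =
    (if (i.+1 < n)%N then A (emb i) (emb j) + A (om (emb i)) (emb j)
     else if ev then 2 * (A (emb i) (emb j) + A (om (emb i)) (emb j))
     else A (emb i) (emb j))%:~R.
  rewrite /coroot_omega; case: ifP => _; last case: ifP => _;
  by rewrite ?pZ ?pD !pairing_sroot_coroot ?intrM ?intrD.
congr (_%:~R); rewrite !mxE -!val_eqE /= /l /ell.
have [] := (ltn_ord i, ltn_ord j).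
by case: ev => /=; do 9?[case: ifP => /=]; rewrite ?orbT /=; lia.
Qed.

(** 'cV[R]_n, the real Cartan subalgebra of the fixed point algebra in the basis
    of its simple coroots h_i^omega, as a subspace of 'cV[R]_(ell n ev). *)
Definition emb_cartan (x : 'cV[R]_n) : 'cV[R]_(ell n ev) :=
  \sum_i x i 0 *: coroot_omega i.

Definition is_Theta
    (Theta : weyl R (typeBC n ev) -> weyl R (typeA (ell n ev))) : Prop :=
  [/\ forall v w, Theta (v * w)%g = (Theta v * Theta w)%g,
      forall i, Theta (srefl R (typeBC n ev) i) = refl_omega i,
      injective Theta & range Theta = Womega].

(** The graph of Phi. *)
Definition Phi Theta (P : set 'cV[R]_(ell n ev)) (hatP : set 'cV[R]_n) : Prop :=
  exists (mu : gfamily R (typeA (ell n ev))) (hatmu : gfamily R (typeBC n ev)),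
  [/\ GGMS P mu, GGMS hatP hatmu &
      forall w, emb_cartan (hatmu w) = mu (Theta w)].

Definition Ptilde (mu : gfamily R (typeA (ell n ev))) : set 'cV[R]_(ell n ev) :=
  [set h | forall w, Womega w -> weyl_ge w h (mu w)].

Definition conditions_i_v (j : 'I_n)
    (mu mu2 : gfamily R (typeA (ell n ev))) : Prop :=
  let k := emb j in
  let sj := refl_omega j in
  let P2 := Ptilde mu2 in
  let c := BZ mu 1%g k - BZ mu (s k) k - 1 in
  let sigma h := s k *m h + c *: h_ k in
  let tau h := s (om k) *m h + c *: h_ (om k) in
  let alpha i h := pairing (sroot R A i) h in
  [/\ forall w, Womega w -> lweak_lt (sj * w)%g w -> mu2 w = mu w,
      mu2 1%g = mu 1%g - coroot_omega j,
      forall w, Womega w -> lweak_lt w (sj * w)%g -> P2 (mu w),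
      (forall w, lweak_lt (s k * w)%g w -> c <= alpha k (mu w) ->
         P2 (sigma (mu w)))
      /\ (forall w, lweak_lt (s (om k) * w)%g w -> c <= alpha (om k) (mu w) ->
         P2 (tau (mu w)))
    & forall w, Womega w -> lweak_lt (sj * w)%g w -> c <= alpha k (mu w) ->
         P2 (sigma (tau (mu w)))].

End Folding.

(* Main.v *)
Require Import Defs.
From mathcomp Require Import boolp classical_sets reals.
From mathcomp Require Import all_boot all_order all_fingroup all_algebra.
From mathcomp Require Import zify ring lra.

(** The Weyl group of type A_l is the symmetric group on l + 1 letters, and its
    chamber weights w Lambda_i correspond to the proper nonempty sets of
    letters: [eps a] being the image of the a-th coordinate, w Lambda_i is the
    sum [wt T] of the [eps a] for a in the set T of the letters that w puts in
    the first positions.  All chamber weights are minuscule, so that the pairing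
    of [wt T] with a simple coroot h_i is 1, 0 or -1, according to which of the
    letters i, i + 1 are in T.  The data D(mu) become a function [bz mu] of T,
    and the tropical Pluecker relations become the three-term relations
    [bz_Plucker], for all a < b < c outside S:
      M(Sb) + M(Sac) = min(M(Sa) + M(Sbc), M(Sc) + M(Sab)).

    The key point is an explicit formula for the lowering operator ([bz_lower],
    [kashiwara_bz]): f_i leaves M_T unchanged unless T contains i and not i + 1,
    in which case it gives M'_T = min(M_T, M_(s_i T) + c).  To see this, write
    T = Si and consider x_S = M(Si) - M(S,i+1), where only the first term is
    changed by f_i.  The three-term relations say that x_S = min(x_(Sa), K) for
    a < i and x_(Sd) = min(x_S, L) for d > i + 1, where K and L involve unchanged
    terms only; so x'_S = min(x_S, c) is inherited when letters greater than i + 1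
    are added and when letters less than i are removed.  It holds for
    S = {1, .., i - 1} by the choice of c, whence it holds for all S.

    For j < n the reflections s_j and s_(omega j) commute, the constants c of the
    two successive operators agree by symmetry, and the composite of the formulas
    gives M' as a minimum of at most four terms ([lower_pair]).  Conditions
    (iii)-(v) for mu' hold since each term bounds M' from above
    ([lower_shift]).  Conversely, let w be fixed by omega.  Then w either has
    both j and omega j as left descents, and mu''_w = mu_w = mu'_w, or it has
    none of them, and then M''_(w Lambda_i) is bounded by each of the four terms,
    using the points that (iii)-(v) put in the polytope, or the inequality that
    makes the term redundant when such a point is not available
    ([Ptilde_mono]). *)

Set Implicit Arguments.
Unset Strict Implicit.
Unset Printing Implicit Defensive.

Import Order.TTheory GRing.Theory Num.Theory.
Local Open Scope ring_scope.

(** * Inversions and reduced words in the symmetric group *)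

Section Inversions.
Variable l : nat.
Implicit Types (i : 'I_l) (a b : 'I_l.+1) (p q : 'S_l.+1).

Definition lo i : 'I_l.+1 := widen_ord (leqnSn l) i.
Definition hi i : 'I_l.+1 := @Ordinal l.+1 i.+1 (ltn_ord i).
Definition adj i : 'S_l.+1 := tperm (lo i) (hi i).


Lemma lo_hi i : lo i != hi i.
Proof. by rewrite -val_eqE /=; lia. Qed.

Lemma adjE i a :
  adj i a = (if a == i :> nat then i.+1 else if a == i.+1 :> nat then i : nat else a) :> nat.
Proof.
rewrite /adj; case: tpermP => [->|->|/eqP + /eqP].
- by rewrite /= eqxx.
- by rewrite /= eqxx; case: eqP => //; lia.
by rewrite -!val_eqE /= => /negPf -> /negPf ->.
Qed.

Lemma adjL i : adj i (lo i) = hi i. Proof. exact: tpermL. Qed.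
Lemma adjR i : adj i (hi i) = lo i. Proof. exact: tpermR. Qed.
Lemma adjK i a : adj i (adj i a) = a. Proof. exact: tpermK. Qed.

Definition invset p : {set 'I_l.+1 * 'I_l.+1} :=
  [set u : 'I_l.+1 * 'I_l.+1 | (u.1 < u.2)%N && (p u.2 < p u.1)%N].
Definition ninv p := #|invset p|.

(** Apart from the pair (i, i + 1) itself, the transposition maps the inversions
    of one permutation bijectively onto those of the other. *)
Lemma ninv_up i p : (p (lo i) < p (hi i))%N -> ninv (adj i * p)%g = (ninv p).+1.
Proof.
move=> ip; rewrite /ninv (cardsD1 (lo i, hi i)).
have -> : (lo i, hi i) \in invset (adj i * p)%g.
  by rewrite inE /= !permM adjL adjR ip leqnn.
congr S; pose f u := (adj i u.1, adj i u.2).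
have fK : cancel f f by case=> a b; rewrite /f /= !adjK.
rewrite -(card_imset (mem (invset p)) (can_inj fK)); apply: eq_card => -[a b].
rewrite -[(a, b)]fK (mem_imset _ _ (can_inj fK)) !inE (can2_eq fK fK) /= !permM.
rewrite !adjK xpair_eqE adjL adjR -!val_eqE /=.
have [[Ea Eb]|nab] : adj i a = lo i /\ adj i b = hi i
  \/ (adj i a != i :> nat) || (adj i b != i.+1 :> nat).
- have [Ea|] := eqVneq (nat_of_ord (adj i a)) i; last by right.
  have [Eb|] := eqVneq (nat_of_ord (adj i b)) i.+1; last by right.
  by left; split; exact: val_inj.
- by rewrite Ea Eb [(p (hi i) < _)%N]ltnNge (ltnW ip) !andbF.
rewrite andbA; congr (_ && _); move: nab; rewrite !adjE.
have := ltn_ord i; do ![case: ifP]; lia.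
Qed.

Lemma ninv_down i p : (p (hi i) < p (lo i))%N -> ninv p = (ninv (adj i * p)%g).+1.
Proof.
by move=> ip; rewrite -(@ninv_up i) ?mulgA ?tperm2 ?mul1g // !permM adjL adjR.
Qed.

Lemma perm_lohi p i : (p (lo i) < p (hi i))%N \/ (p (hi i) < p (lo i))%N.
Proof.
have := lo_hi i; rewrite -(inj_eq (@perm_inj _ p)) -val_eqE /=; lia.
Qed.

Lemma ninv_adj i p : (ninv (adj i * p)%g <= (ninv p).+1)%N.
Proof. by have [/ninv_up->|/ninv_down->] := perm_lohi p i; lia. Qed.

Lemma ninv1 : ninv 1 = 0%N.
Proof. by apply: eq_card0 => -[a b]; rewrite !inE !perm1 /=; lia. Qed.

Lemma incr_perm_eq1 p : (forall i, p (lo i) < p (hi i))%N -> p = 1%g.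
Proof.
move=> pincr.
have step (a b : 'I_l.+1) : b = a.+1 :> nat -> (p a < p b)%N.
  move=> ab; have al : (a < l)%N by have := ltn_ord b; lia.
  have := pincr (Ordinal al).
  by congr (p _ < p _)%N; apply: val_inj; rewrite /=.
have ge_id k a : a = k :> nat -> (k <= p a)%N.
  elim: k a => // k IH a ak.
  have kl : (k < l.+1)%N by have := ltn_ord a; lia.
  have := IH (Ordinal kl) erefl; have := step (Ordinal kl) a ak; lia.
have le_id k a : (a + k = l)%N -> (p a + k <= l)%N.
  elim: k a => [|k IH] a ak; first by have := ltn_ord (p a); lia.
  have kl : (a.+1 < l.+1)%N by lia.
  have Hs : (a.+1 + k = l)%N by lia.
  have := IH (Ordinal kl) Hs; have := step a (Ordinal kl) erefl; lia.
apply/permP => a; rewrite perm1; apply: val_inj => /=.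
have := ge_id a a erefl; have := @le_id (l - a)%N a; have := ltn_ord a; lia.
Qed.

(** Sorting: a permutation other than 1 has a descent, and removing it lowers the
    number of inversions by one. *)
Lemma perm_word p : exists2 u : seq 'I_l, size u = ninv p & p = (\prod_(i <- u) adj i)%g.
Proof.
have [n] := ubnP (ninv p); elim: n p => // n IHn p; rewrite ltnS => pn.
have [/forallP pincr|] := boolP [forall i, p (lo i) < p (hi i)]%N.
  rewrite (incr_perm_eq1 pincr); exists [::]; rewrite ?big_nil //=.
  by rewrite ninv1.
case/forallPn=> i /negP di.
have {}di : (p (hi i) < p (lo i))%N by case: (perm_lohi p i).
have Np := ninv_down di.
have [|u uN uE] := IHn (adj i * p)%g; first by rewrite -Np.
by exists (i :: u); rewrite ?big_cons -?uE /= ?mulgA ?tperm2 ?mul1g // uN -Np.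
Qed.

Lemma ninv_word (u : seq 'I_l) : (ninv (\prod_(i <- u) adj i)%g <= size u)%N.
Proof.
elim: u => [|i u IHu]; rewrite ?big_nil ?ninv1 // big_cons.
by apply: leq_trans (ninv_adj _ _) _.
Qed.

Lemma perm_of_seq (t : seq 'I_l.+1) : uniq t -> size t = l.+1 ->
  exists p, forall a, p a = index a t :> nat.
Proof.
move=> tU tS.
have tT a : a \in t.
  have /subset_cardP : #|t| = #|'I_l.+1| by rewrite (card_uniqP tU) tS card_ord.
  by move=> /(_ (subset_predT _)) ->.
have ti a : (index a t < l.+1)%N by have := tT a; rewrite -index_mem tS.
have inj : injective (fun a => Ordinal (ti a)).
  by move=> a b [] /(congr1 (nth a t)); rewrite !nth_index.
by exists (perm inj) => a; rewrite permE.
Qed.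

End Inversions.

(** * The Weyl group of type A as a symmetric group *)

Section TypeAWeyl.
Variables (R : realType) (l : nat).
Local Notation W := (weyl R (typeA l)).
Local Notation s_ := (srefl R (typeA l)).
Implicit Types (i : 'I_l) (a b : 'I_l.+1) (S : {set 'I_l.+1}) (w : W).

(** With the fundamental weights numbered from 1 and Lambda_0 = Lambda_(l + 1) = 0,
    this is Lambda_(a + 1) - Lambda_a; the sum of these coordinates is zero. *)
Definition eps a : 'rV[R]_l :=
  \row_p ((p == a :> nat)%:R - (p.+1 == a :> nat)%:R).

Definition wt S : 'rV[R]_l := \sum_(a in S) eps a.

Lemma wtE S i : wt S 0 i = (lo i \in S)%:R - (hi i \in S)%:R.
Proof.
have sum_at b : \sum_(a in S) (b == a)%:R = (b \in S)%:R :> R.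
  have [bS|bS] := boolP (b \in S).
    by rewrite (bigD1 b) //= eqxx big1 ?addr0 // => a /andP[_ /negPf]; rewrite eq_sym => ->.
  by rewrite big1 // => a aS; case: eqP aS bS => // ->; case: (a \in S).
rewrite summxE -!sum_at -sumrB; apply: eq_bigr => a _.
by rewrite mxE -!val_eqE.
Qed.

Lemma fundw_wt i : fundw R i = wt [set a : 'I_l.+1 | (a <= i)%N].
Proof.
apply/rowP=> p; rewrite wtE !mxE !inE eqxx /= -val_eqE /=.
by case: (ltngtP p i); rewrite ?subrr ?subr0.
Qed.

Lemma sroot_eps i : sroot R (typeA l) i = eps (lo i) - eps (hi i).
Proof.
apply/rowP=> p; rewrite !mxE -!val_eqE /= eqSS [i.+1 == p :> nat]eq_sym.
have [->|pi] := eqVneq (p : nat) i.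
  by rewrite ![_ == _.+1]ltn_eqF // [_.+1 == _]gtn_eqF //= -[2%:~R]/(2%:R : R); ring.
have [E|_] := eqVneq p.+1 (i : nat).
  by rewrite (_ : (p == i.+1 :> nat) = false) ?mulrN1z /=; [ring | lia].
by case: eqP => _; rewrite ?mulrN1z /= -?[0%:~R]/(0 : R); ring.
Qed.

Lemma eps_coroot a i :
  pairing (eps a) (coroot R i) = (a == lo i)%:R - (a == hi i)%:R.
Proof.
by rewrite /pairing /coroot -colE !mxE ![a == _]eq_sym -!val_eqE.
Qed.

Lemma eps_refl a i : eps a *m refl_mx R (typeA l) i = eps (adj i a).
Proof.
rewrite /refl_mx mulmxBr mulmx1 mulmxA [eps a *m _]mx11_scalar mul_scalar_mx.
rewrite -/(pairing _ _) eps_coroot sroot_eps /adj.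
have := lo_hi i; case: tpermP => [->|->|/eqP/negPf-> /eqP/negPf->].
- by rewrite eqxx => /negPf->; rewrite subr0 scale1r opprB addrC subrK.
- by rewrite eqxx eq_sym => /negPf->; rewrite sub0r scaleN1r opprK addrC subrK.
by rewrite subrr scale0r subr0.
Qed.

Lemma eps_inj : injective eps.
Proof.
have neq a b : (a < b)%N -> eps a <> eps b.
  move=> ab; have al : (a < l)%N by have := ltn_ord b; lia.
  move/rowP/(_ (Ordinal al)); rewrite !mxE /= eqxx.
  have -> : (a.+1 == a :> nat) = false by lia.
  have -> : (a == b :> nat) = false by lia.
  by case: eqP => _ /=; lra.
move=> a b eab; apply: val_inj => /=.
by have [/neq|/neq/(_ (esym eab))|] := ltngtP a b.
Qed.

Lemma wperm_ex w : exists q : 'S_l.+1, forall a, eps a *m w = eps (q a).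
Proof.
have /asboolP[u ->] := weyl_mxP w; elim: u => [|i u [q qE]] /=.
  by exists 1%g => a; rewrite mulmx1 perm1.
by exists (adj i * q)%g => a; rewrite permM mulmxA eps_refl qE.
Qed.

(** This is the inverse of the usual permutation of the letters, because
    matrices act on weights on the right; it makes [wperm] a morphism for the
    composition order of permutations. *)
Definition wperm w : 'S_l.+1 := sval (cid (wperm_ex w)).

Lemma eps_wperm a w : eps a *m w = eps (wperm w a).
Proof. exact: (svalP (cid (wperm_ex w))). Qed.

Lemma wperm_unique w (q : 'S_l.+1) : (forall a, eps a *m w = eps (q a)) -> wperm w = q.
Proof. by move=> qE; apply/permP=> a; apply: eps_inj; rewrite -eps_wperm. Qed.

Lemma wpermM v w : wperm (v * w)%g = (wperm v * wperm w)%g.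
Proof. by apply: wperm_unique => a; rewrite permM /= mulmxA !eps_wperm. Qed.

Lemma wperm1 : wperm 1%g = 1%g.
Proof. by apply: wperm_unique => a; rewrite perm1 /= mulmx1. Qed.

Lemma wpermV w : wperm w^-1%g = (wperm w)^-1%g.
Proof. by apply: (mulgI (wperm w)); rewrite -wpermM !mulgV wperm1. Qed.

Lemma wperm_refl i : wperm (s_ i) = adj i.
Proof. by apply: wperm_unique => a; rewrite /= eps_refl. Qed.

Lemma wperm_inj : injective wperm.
Proof.
move=> v w vw; apply: val_inj; apply/row_matrixP=> i /=; rewrite !rowE.
rewrite -[delta_mx 0 i]/(fundw R i) fundw_wt /wt !mulmx_suml.
by apply: eq_bigr => a _; rewrite !eps_wperm vw.
Qed.

Lemma wperm_word (u : seq 'I_l) :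
  wperm (word _ _ u) = (\prod_(i <- u) adj i)%g.
Proof.
by elim: u => [|i u IHu]; rewrite /word ?big_nil ?wperm1 // !big_cons wpermM wperm_refl IHu.
Qed.

Lemma wperm_surj (q : 'S_l.+1) : exists w, wperm w = q.
Proof. by have [u _ ->] := perm_word q; exists (word _ _ u); rewrite wperm_word. Qed.

(** Inversions bound the size of any word from below, and sorting provides a
    word of that size. *)
Lemma lenE w : len w = ninv (wperm w).
Proof.
rewrite /len; case: ex_minnP => m /existsP[u /eqP uE] m_min.
apply/eqP; rewrite eqn_leq; apply/andP; split; last first.
  by rewrite uE wperm_word -[X in (_ <= X)%N](size_tuple u) ninv_word.
apply: m_min; have [u' u'N u'E] := perm_word (wperm w).
apply/existsP; exists (tcast u'N (in_tuple u')); apply/eqP/wperm_inj.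
by rewrite wperm_word val_tcast -u'E.
Qed.

Lemma len_srefl i : len (s_ i) = 1%N.
Proof.
rewrite lenE wperm_refl -[adj i]mulg1 ninv_up ?ninv1 // !perm1 /=; lia.
Qed.

Lemma lenV w : len w^-1%g = len w.
Proof.
suff le (v : W) : (len v^-1%g <= len v)%N.
  by apply/eqP; rewrite eqn_leq le -{1}[w]invgK le.
rewrite !lenE wpermV; have [u <- ->] := perm_word (wperm v).
suff -> : ((\prod_(i <- u) adj i)^-1 = \prod_(i <- rev u) adj i)%g.
  by rewrite -(size_rev u) ninv_word.
elim: u => [|i u IHu]; first by rewrite /rev /= !big_nil invg1.
rewrite rev_cons -cats1 big_cat big_seq1 big_cons invMg IHu; congr (_ * _)%g.
by rewrite /adj tpermV.
Qed.

End TypeAWeyl.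

(** * Descents and weak orders *)

Section WeakOrder.
Variables (R : realType) (l : nat).
Local Notation W := (weyl R (typeA l)).
Local Notation s_ := (srefl R (typeA l)).
Implicit Types (i j : 'I_l) (a b : 'I_l.+1) (w x : W).

Lemma sreflK i : (s_ i * s_ i)%g = 1%g.
Proof. by apply: val_inj; rewrite /= refl_mxK. Qed.

Lemma rweak_lt_srefl w i a b : (a < b)%N ->
  wperm w a = lo i -> wperm w b = hi i -> rweak_lt w (w * s_ i)%g.
Proof.
move=> ab wa wb; exists (s_ i); split=> //.
  by apply/eqP=> /(congr1 (@len _ _ _)); rewrite len_srefl lenE wperm1 ninv1.
rewrite len_srefl addn1 -(lenV (w * _)%g) -(lenV w) invMg !lenE wpermM !wpermV.
rewrite wperm_refl /adj tpermV -/(adj i) ninv_up //.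
by rewrite -wa -wb !permK.
Qed.

Lemma lweak_lt_invol x w : (x * x = 1)%g ->
  lweak_lt (x * w)%g w <-> x != 1%g /\ len w = (len x + len (x * w)%g)%N.
Proof.
move=> xx; split=> [[y [y1 wE lenw]]|[x1 lenw]]; last first.
  by exists x; rewrite mulgA xx mul1g.
have yx : y = x; last by subst y.
have yx1 : (y * x)%g = 1%g by apply: (mulIg w); rewrite -mulgA mul1g.
by rewrite -[y]mulg1 -xx mulgA yx1 mul1g.
Qed.

(** Left descents: letters i and i + 1 are compared by their positions. *)
Definition descent w i := (wperm w (hi i) < wperm w (lo i))%N.

Lemma len_down w i : descent w i -> len w = (len (s_ i * w)%g).+1.
Proof. by move=> di; rewrite !lenE wpermM wperm_refl -ninv_down. Qed.

Lemma len_up w i : ~~ descent w i -> len (s_ i * w)%g = (len w).+1.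
Proof.
move=> di; rewrite !lenE wpermM wperm_refl ninv_up //.
by case: (perm_lohi (wperm w) i) => //; move/negP: di.
Qed.

Lemma srefl_neq1 i : s_ i != 1%g.
Proof. by apply/eqP=> /(congr1 (@len _ _ _)); rewrite len_srefl lenE wperm1 ninv1. Qed.

Lemma lweak_lt_srefl w i : lweak_lt (s_ i * w)%g w <-> descent w i.
Proof.
rewrite (lweak_lt_invol w (sreflK i)) len_srefl; split=> [[_ lenw]|di].
  by apply: contraPT lenw => /len_up ->; move: (len w); lia.
by rewrite srefl_neq1 add1n -len_down.
Qed.

Lemma descent_srefl w i : descent (s_ i * w)%g i = ~~ descent w i.
Proof.
rewrite /descent wpermM wperm_refl !permM adjL adjR.
by have [] := perm_lohi (wperm w) i; lia.
Qed.

Variables (i j : 'I_l).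
Hypothesis ij : (i.+1 < j)%N.

Lemma adj_far : ((adj i (lo j) = lo j) * (adj i (hi j) = hi j) *
   (adj j (lo i) = lo i) * (adj j (hi i) = hi i))%type.
Proof.
by do !split; apply: ord_inj; rewrite adjE /=; do ![case: ifP => /=]; lia.
Qed.

Lemma srefl_comm : (s_ i * s_ j = s_ j * s_ i)%g.
Proof.
apply: wperm_inj; rewrite !wpermM !wperm_refl; apply/permP=> a; rewrite !permM.
by apply: ord_inj; rewrite !adjE; do ![case: ifP => /=]; lia.
Qed.

Lemma descent_far w : descent (s_ i * w)%g j = descent w j /\
  descent (s_ j * w)%g i = descent w i.
Proof. by rewrite /descent !wpermM !wperm_refl !permM !adj_far. Qed.

Lemma srefl2K : (s_ i * s_ j * (s_ i * s_ j) = 1)%g.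
Proof. by rewrite {2}srefl_comm mulgA -(mulgA (s_ i)) sreflK mulg1 sreflK. Qed.

Lemma len_srefl2 : len (s_ i * s_ j)%g = 2%N.
Proof.
rewrite len_up ?len_srefl // -(mulg1 (s_ j)) (descent_far _).2.
by rewrite /descent wperm1 !perm1 /= -leqNgt.
Qed.

(** The length of the product being 2, both reflections must lower the length. *)
Lemma lweak_lt_srefl2 w :
  lweak_lt (s_ i * s_ j * w)%g w <-> descent w i /\ descent w j.
Proof.
rewrite (lweak_lt_invol w srefl2K) len_srefl2 -mulgA.
rewrite -(descent_far w).2; split=> [[_]|[di dj]]; last first.
  split; last by rewrite (len_down dj) (len_down di).
  by apply/eqP=> /(congr1 (@len _ _ _)); rewrite len_srefl2 lenE wperm1 ninv1.
have [/len_down|/len_up] := boolP (descent (s_ j * w)%g i);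
have [/len_down|/len_up] := boolP (descent w j) => //;
move=> E1 E2 E3; exfalso; move: E1 E2 E3;
by move: (len w) (len (s_ j * w)%g) (len (s_ i * (s_ j * w))%g) => L Y X; lia.
Qed.

Lemma descent_srefl2 w : descent (s_ i * s_ j * w)%g i = ~~ descent w i /\
  descent (s_ i * s_ j * w)%g j = ~~ descent w j.
Proof.
by rewrite -mulgA descent_srefl (descent_far _).1 (descent_far _).2 descent_srefl.
Qed.

Lemma lweak_gt_srefl2 w : ~~ descent w i -> ~~ descent w j ->
  lweak_lt w (s_ i * s_ j * w)%g.
Proof.
move=> di dj; rewrite -{1}[w]mul1g -srefl2K -mulgA; apply/lweak_lt_srefl2.
by have [-> ->] := descent_srefl2 w.
Qed.

End WeakOrder.

(** * Chamber weights and BZ data *)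

Section BZdata.
Variables (R : realType) (l : nat).
Local Notation W := (weyl R (typeA l)).
Local Notation s_ := (srefl R (typeA l)).
Implicit Types (i : 'I_l) (a b c : 'I_l.+1) (S T : {set 'I_l.+1}) (w v : W).
Implicit Types (mu : gfamily R (typeA l)) (h : 'cV[R]_l).

Lemma pairingDr (x : 'rV[R]_l) h h' : pairing x (h + h') = pairing x h + pairing x h'.
Proof. by rewrite /pairing mulmxDr mxE. Qed.
Lemma pairingBl (x y : 'rV[R]_l) h : pairing (x - y) h = pairing x h - pairing y h.
Proof. by rewrite /pairing mulmxBl mxE [in X in _ + X]mxE. Qed.
Lemma pairingZr (x : 'rV[R]_l) k h : pairing x (k *: h) = k * pairing x h.
Proof. by rewrite /pairing -scalemxAr mxE. Qed.
Lemma pairing0l h : pairing 0 h = 0 :> R.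
Proof. by rewrite /pairing mul0mx mxE. Qed.

(** The letters in the first i + 1 positions: the set attached to w Lambda_i. *)
Definition iset w i : {set 'I_l.+1} := [set a | (wperm w a <= i)%N].

Lemma weight_act_fundw w i : weight_act w (fundw R i) = wt R (iset w i).
Proof.
rewrite /weight_act fundw_wt /wt mulmx_suml.
rewrite [RHS](reindex_inj (@perm_inj _ (wperm w^-1%g))) /=.
apply: eq_big => [a|a _]; first by rewrite !inE wpermV permKV.
exact: (eps_wperm a w^-1%g).
Qed.

Lemma BZE mu w i : BZ mu w i = pairing (wt R (iset w i)) (mu w).
Proof. by rewrite /BZ weight_act_fundw. Qed.

Lemma weyl_geE w h h' : weyl_ge w h h' <->
  forall i, pairing (wt R (iset w i)) h' <= pairing (wt R (iset w i)) h.
Proof.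
have E i g : ((w^-1)%g *m g) i 0 = pairing (wt R (iset w i)) g.
  rewrite -weight_act_fundw /weight_act /pairing -mulmxA /fundw -rowE.
  by rewrite [RHS]mxE.
split=> ge i; have := ge i; first by rewrite mxE [X in _ + X]mxE !E subr_ge0.
by rewrite mxE [X in _ + X]mxE !E subr_ge0.
Qed.

Lemma weyl_ge_anti w h h' : weyl_ge w h h' -> weyl_ge w h' h -> h = h'.
Proof.
move=> hh' h'h; apply: (can_inj (mulKmx (weyl_unit w^-1%g))).
apply/colP=> i; apply/eqP; rewrite eq_le.
have := hh' i; rewrite mxE [X in _ + X]mxE subr_ge0 => ->.
by have := h'h i; rewrite mxE [X in _ + X]mxE subr_ge0 => ->.
Qed.

Lemma GGMS_unique (P : classical_sets.set 'cV[R]_l) mu mu' :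
  GGMS P mu -> GGMS P mu' -> mu = mu'.
Proof.
move=> [[mug _] ->] [[mu'g _] E]; apply: funext => w.
have mu_in : polytope mu (mu w) by move=> w'; exact: mug.
have mu'_in : polytope mu' (mu' w) by move=> w'; exact: mu'g.
by apply: (@weyl_ge_anti w); [rewrite E in mu_in | rewrite -E in mu'_in].
Qed.

(** Allowing all m, and not only 0 < m <= l, covers the empty and the full sets,
    whose weight is zero. *)
Definition initial w S := exists m, forall a, (wperm w a < m)%N = (a \in S).

Lemma initial_iset w i : initial w (iset w i).
Proof. by exists i.+1 => a; rewrite inE ltnS. Qed.

Lemma initial_ex S : exists w, initial w S.
Proof.
pose t := enum S ++ enum (~: S).
have tU : uniq t.
  rewrite cat_uniq !enum_uniq /= andbT; apply/hasPn=> a.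
  by rewrite !mem_enum inE.
have tS : size t = l.+1 by rewrite size_cat -!cardE cardsC card_ord.
have [p pE] := perm_of_seq tU tS; have [w wE] := wperm_surj R p.
exists w, (size (enum S)) => a; rewrite wE pE index_cat mem_enum.
by case: ifP => aS; [rewrite index_mem mem_enum | rewrite ltnNge leq_addr].
Qed.

(** The component of D(mu) at the weight [wt S]; the choice of the Weyl group
    element is immaterial by [bz_initial]. *)
Definition bz mu S := pairing (wt R S) (mu (sval (cid (initial_ex S)))).

(** The inequalities defining pseudo-Weyl polytopes say that M_T is the minimum
    of the weight over the polytope. *)
Lemma initial_le mu v w S : pseudoWeyl mu -> initial v S ->
  pairing (wt R S) (mu v) <= pairing (wt R S) (mu w).
Proof.
move=> [mug _] [m vS].
have [/andP[m0 ml]|triv] : (0 < m <= l)%N \/ (m == 0%N) || (l < m)%N by lia.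
  have ml' : (m.-1 < l)%N by lia.
  have -> : S = iset v (Ordinal ml').
    by apply/setP=> a; rewrite inE -vS /=; lia.
  by move/weyl_geE: (mug v w); exact.
suff -> : wt R S = 0 by rewrite !pairing0l.
apply/rowP=> p; rewrite wtE mxE -!vS.
have := ltn_ord (wperm v (lo p)); have := ltn_ord (wperm v (hi p)).
by case/orP: triv => [/eqP->|lm] ? ?; rewrite ?subrr // !(leq_trans _ lm) ?subrr.
Qed.

Lemma bz_le mu w S : pseudoWeyl mu -> bz mu S <= pairing (wt R S) (mu w).
Proof. by move=> mupW; apply: (initial_le _ mupW (svalP (cid (initial_ex S)))). Qed.

Lemma bz_initial mu w S : pseudoWeyl mu -> initial w S ->
  bz mu S = pairing (wt R S) (mu w).
Proof.
by move=> mupW wS; apply/eqP; rewrite eq_le bz_le //= initial_le.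
Qed.

Lemma BZ_bz mu w i : pseudoWeyl mu -> BZ mu w i = bz mu (iset w i).
Proof. by move=> mupW; rewrite BZE (bz_initial mupW (initial_iset w i)). Qed.

Lemma polytope_bz mu h : pseudoWeyl mu ->
  (forall S, bz mu S <= pairing (wt R S) h) -> polytope mu h.
Proof.
by move=> mupW hS w; apply/weyl_geE=> i; rewrite -BZE BZ_bz.
Qed.

(** The relation at the element w that lists S first, then a, b, c, for the
    positions #|S| and #|S| + 1. *)
Lemma bz_Plucker mu S a b c : pseudoWeyl mu -> tropical_Plucker mu ->
  (a < b < c)%N -> a \notin S -> b \notin S -> c \notin S ->
  bz mu (b |: S) + bz mu (a |: (c |: S)) =
  Num.min (bz mu (a |: S) + bz mu (b |: (c |: S)))
          (bz mu (c |: S) + bz mu (a |: (b |: S))).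
Proof.
move=> mupW muP /andP[ab bc] aS bS cS.
pose U := a |: (b |: (c |: S)); pose t := enum S ++ [:: a, b, c & enum (~: U)].
have neq : (((a == b) = false) * ((a == c) = false) * ((b == c) = false))%type.
  by rewrite -!val_eqE /= !ltn_eqF // (ltn_trans ab).
have cardU : #|U| = #|S|.+3.
  by rewrite !cardsU1 !inE (negPf aS) (negPf bS) (negPf cS) !neq.
have tS : size t = l.+1.
  have := cardsC U; rewrite size_cat /= -!cardE cardU card_ord => cU.
  by apply: etrans cU; rewrite !addnS !addSn.
have tU : uniq t.
  rewrite cat_uniq !enum_uniq /= !inE !mem_enum !inE !eqxx ?orbT /= !neq.
  rewrite (negPf aS) (negPf bS) (negPf cS) /=.
  have -> : has [in enum S] (enum (~: U)) = false.
    by apply/negbTE/hasPn=> x; rewrite !mem_enum !inE !negb_or => /and4P[].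
  exact: enum_uniq.
have [p pE] := perm_of_seq tU tS; have [w wE] := wperm_surj R p.
have k1 : (#|S| < l)%N by have := max_card [in U]; rewrite card_ord cardU; lia.
have k2 : (#|S|.+1 < l)%N by have := max_card [in U]; rewrite card_ord cardU; lia.
pose i := Ordinal k1; pose j := Ordinal k2.
have wpE x : wperm w x = (if x \in S then index x (enum S)
    else #|S| + index x [:: a, b, c & enum (~: U)])%N :> nat.
  by rewrite wE pE index_cat mem_enum cardE.
have wa : wperm w a = #|S| :> nat.
  by rewrite wpE (negPf aS) /= eqxx addn0.
have wb : wperm w b = #|S|.+1 :> nat.
  by rewrite wpE (negPf bS) /= neq eqxx addn1.
have wc : wperm w c = #|S|.+2 :> nat.
  by rewrite wpE (negPf cS) /= !neq eqxx addn2.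
have inS x : (x \in S) = (wperm w x < #|S|)%N.
  by rewrite wpE; case: ifP => xS; [rewrite cardE index_mem mem_enum | rewrite ltnNge leq_addr].
have at_pos y x : (x == y) = (wperm w x == wperm w y :> nat).
  by rewrite -(inj_eq (@perm_inj _ (wperm w)) x y) -val_eqE.
have ij : i != j by rewrite -val_eqE /=; lia.
have wi : rweak_lt w (w * s_ i)%g.
  by apply: (rweak_lt_srefl ab); apply: ord_inj.
have wj : rweak_lt w (w * s_ j)%g.
  by apply: (rweak_lt_srefl bc); apply: ord_inj.
have [PL _ _] := muP w i j ij wi wj.
have Aij : typeA l i j = -1 /\ typeA l j i = -1.
  by rewrite !mxE [j == i]eq_sym (negPf ij) /= !eqxx orbT.
have {PL Aij} := PL Aij.1 Aij.2.
rewrite /= !BZ_bz //.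
have E T u k : iset (w * word R (typeA l) u)%g k = T ->
  bz mu T = bz mu (iset (w * word R (typeA l) u)%g k) by move=> ->.
move=> PLb.
rewrite (E (b |: S) [:: i] i) ?(E (a |: (c |: S)) [:: j] j)
  ?(E (a |: S) [::] i) ?(E (b |: (c |: S)) [:: i; j] j)
  ?(E (c |: S) [:: j; i] i) ?(E (a |: (b |: S)) [::] j) //;
  apply/setP=> x;
  rewrite !inE ?(at_pos a) ?(at_pos b) ?(at_pos c) ?wa ?wb ?wc inS
    wpermM wperm_word ?big_cons big_nil ?mulg1 ?mul1g ?permM ?adjE /=;
  move: (nat_of_ord (wperm w x)) => z; do ?[case: ifP => //]; lia.
Qed.
End BZdata.

(** * The lowering operators on BZ data *)

Section Lowering.
Variables (R : realType) (l : nat).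
Local Notation W := (weyl R (typeA l)).
Local Notation s_ := (srefl R (typeA l)).
Implicit Types (i j : 'I_l) (a b c : 'I_l.+1) (S T : {set 'I_l.+1}) (w v : W).
Implicit Types (mu : gfamily R (typeA l)) (M : {set 'I_l.+1} -> R) (k : R).

Definition swap i T := [set a | adj i a \in T].

(** The effect of f_i on BZ data, where k is the constant c of that operator. *)
Definition lower i k M T :=
  if (lo i \in T) && (hi i \notin T) then Num.min (M T) (M (swap i T) + k) else M T.

(** If w does not have the descent i, then i and i + 1 are both in T or both
    outside T, so that s_i w also has T as an initial segment. *)
Lemma initial_descent i T : ~~ ((lo i \in T) && (hi i \notin T)) ->
  exists2 w : W, initial w T & descent w i.
Proof.
move=> iT; have [w [m wT]] := initial_ex R T.
have [dw|dw] := boolP (descent w i); first by exists w => //; exists m.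
exists (s_ i * w)%g; last by rewrite descent_srefl.
exists m => a; rewrite wpermM wperm_refl permM wT; rewrite -!wT in iT.
move: dw; rewrite /descent -leqNgt => dw.
rewrite -!wT /adj; case: tpermP => [->|->|//]; lia.
Qed.

Section Formula.
Variables (i : 'I_l) (mu mu' : gfamily R (typeA l)).
Hypotheses (mupW : pseudoWeyl mu) (mu'pW : pseudoWeyl mu').
Hypotheses (muP : tropical_Plucker mu) (mu'P : tropical_Plucker mu').
Hypothesis mu'1 : mu' 1%g = mu 1%g - coroot R i.
Hypothesis mu'down : forall w, lweak_lt (s_ i * w)%g w -> mu' w = mu w.

Let M := bz mu.
Let M' := bz mu'.
Let base := [set a : 'I_l.+1 | (a <= i)%N].
Let k := M base - M (swap i base) - 1.

Lemma bz_lower_id T : ~~ ((lo i \in T) && (hi i \notin T)) -> M' T = M T.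
Proof.
case/initial_descent=> w wT /lweak_lt_srefl /mu'down mu'w.
by rewrite /M' /M !(bz_initial _ wT) // mu'w.
Qed.

Let lowerable S := M' (lo i |: S) = Num.min (M (lo i |: S)) (M (hi i |: S) + k).

Lemma swapU S : lo i \notin S -> hi i \notin S -> swap i (lo i |: S) = hi i |: S.
Proof.
move=> loS hiS; apply/setP=> a; rewrite !inE /adj.
case: tpermP => [->|->|/eqP/negPf-> /eqP/negPf->//].
  by rewrite (negPf loS) (negPf hiS) eq_sym.
by rewrite !eqxx.
Qed.

Lemma baseE : base = lo i |: [set a : 'I_l.+1 | (a < i)%N].
Proof. by apply/setP=> a; rewrite !inE leq_eqVlt -val_eqE. Qed.

(** For T = [1, i], the choice of k says that M'_T = M_T - 1 = M_(s_i T) + k. *)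
Lemma lowerable_base : lowerable [set a : 'I_l.+1 | (a < i)%N].
Proof.
have b1 : initial (1%g : W) base by exists i.+1 => a; rewrite wperm1 perm1 inE ltnS.
have M'b : M' base = M base - 1.
  rewrite /M' /M !(bz_initial _ b1) // mu'1 -scaleN1r pairingDr pairingZr.
  by rewrite -fundw_wt pairing_fundw_coroot eqxx mulN1r.
rewrite /lowerable -baseE M'b -swapU ?inE ?ltnn //= ?ltnNge ?leqnSn // -baseE.
rewrite /k; case: ltrP => //; lra.
Qed.

(** The relation for i < i + 1 < d reads x_(Sd) = min(x_S, L), where
    x_S = M(Si) - M(S,i+1) and L involves unchanged terms only. *)
Lemma lowerable_add S d : lo i \notin S -> hi i \notin S -> d \notin S ->
  (hi i < d)%N -> lowerable S -> lowerable (d |: S).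
Proof.
move=> loS hiS dS id SM.
have ld : (lo i < hi i < d)%N by rewrite /= ltnSn.
have := bz_Plucker mupW muP ld loS hiS dS.
have := bz_Plucker mu'pW mu'P ld loS hiS dS.
rewrite /lowerable in SM *; rewrite -/M -/M' SM.
have neq : ((lo i == d) = false) * ((hi i == d) = false) * ((lo i == hi i) = false).
  by rewrite -!val_eqE /= !ltn_eqF // (ltn_trans _ id) /=.
rewrite (@bz_lower_id (hi i |: S)) ?inE ?eqxx ?andbF //.
rewrite (@bz_lower_id (hi i |: (d |: S))) ?inE ?eqxx ?andbF //.
rewrite (@bz_lower_id (d |: S)) ?inE ?neq ?(negPf loS) //.
rewrite (@bz_lower_id (lo i |: (hi i |: S))) ?inE ?eqxx ?orbT ?andbF //.
rewrite /Num.min; do ![case: ifP]; lra.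
Qed.

(** The relation for a < i < i + 1 reads x_S = min(x_(Sa), K), with x_S as before
    and K involving unchanged terms only. *)
Lemma lowerable_remove S a : lo i \notin S -> hi i \notin S -> a \notin S ->
  (a < i)%N -> lowerable (a |: S) -> lowerable S.
Proof.
move=> loS hiS aS ai SM.
have al : (a < lo i < hi i)%N by rewrite /= ltnSn ai.
have := bz_Plucker mupW muP al aS loS hiS.
have := bz_Plucker mu'pW mu'P al aS loS hiS.
rewrite /lowerable !(setUCA _ [set a]) in SM *; rewrite -/M -/M' SM.
have neq : ((lo i == a) = false) * ((hi i == a) = false) * ((lo i == hi i) = false).
  by rewrite -!val_eqE /=; split; [split|]; lia.
rewrite (@bz_lower_id (hi i |: S)) ?inE ?eqxx ?andbF //.
rewrite (@bz_lower_id (a |: (hi i |: S))) ?inE ?eqxx ?orbT ?andbF //.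
rewrite (@bz_lower_id (a |: S)) ?inE ?neq ?(negPf loS) //.
rewrite (@bz_lower_id (lo i |: (hi i |: S))) ?inE ?eqxx ?orbT ?andbF //.
rewrite /Num.min; do ![case: ifP]; lra.
Qed.

(** S is reached from the letters less than i by adding the letters of S greater
    than i + 1, then removing the letters less than i outside S.  The induction
    runs backwards along this path. *)
Lemma lowerable_all S : lo i \notin S -> hi i \notin S -> lowerable S.
Proof.
pose S0 := [set a : 'I_l.+1 | (a < i)%N].
have [m] := ubnP #|S0 :\: S|; elim: m S => // m IHm S; rewrite ltnS => Sm loS hiS.
have [/eqP|[a]] := set_0Vmem (S0 :\: S); last first.
  rewrite 2!inE => /andP[aS ai]; apply: (@lowerable_remove S a) => //.
  apply: IHm; last 2 first.
  - by rewrite !inE negb_or loS andbT -val_eqE /=; lia.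
  - by rewrite !inE negb_or hiS andbT -val_eqE /=; lia.
  apply: leq_trans Sm; apply: proper_card; apply/properP; split.
    by apply: setDS; apply: subsetUr.
  by exists a; rewrite !inE ?eqxx ?aS.
rewrite setD_eq0 => S0S; have [p] := ubnP #|S|.
elim: p S S0S loS hiS {m IHm Sm} => // p IHp S S0S loS hiS; rewrite ltnS => Sp.
have [/eqP|[d]] := set_0Vmem (S :\: S0).
  rewrite setD_eq0 => SS0; suff -> : S = S0 by exact: lowerable_base.
  by apply/eqP; rewrite eqEsubset S0S SS0.
rewrite !inE -leqNgt => /andP[id dS].
rewrite -(setD1K dS); apply: lowerable_add; rewrite ?inE ?(negPf loS) ?(negPf hiS) ?andbF ?eqxx //.
  move: id; rewrite leq_eqVlt => /orP[/eqP E|].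
    by move: loS; rewrite (_ : lo i = d) ?dS //; apply: ord_inj.
  rewrite leq_eqVlt => /orP[/eqP E|//].
  by move: hiS; rewrite (_ : hi i = d) ?dS //; apply: ord_inj.
apply: IHp; rewrite ?inE ?(negPf loS) ?(negPf hiS) ?andbF //.
  rewrite subsetD1 S0S inE -leqNgt //.
by rewrite (cardsD1 d S) dS in Sp.
Qed.

Lemma bz_lower T : M' T = lower i k M T.
Proof.
rewrite /lower; case: ifPn => [/andP[loT hiT]|]; last exact: bz_lower_id.
rewrite -(setD1K loT) swapU ?inE ?eqxx ?(negPf hiT) ?andbF //.
by apply: lowerable_all; rewrite !inE ?eqxx ?(negPf hiT) ?andbF.
Qed.

End Formula.

Lemma kashiwara_bz i P P' mu mu' : kashiwara (typeA l) i P P' ->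
  GGMS P mu -> GGMS P' mu' ->
  [/\ mu' 1%g = mu 1%g - coroot R i,
      forall w, descent w i -> mu' w = mu w &
      forall T, bz mu' T =
        lower i (BZ mu 1%g i - BZ mu (s_ i) i - 1) (bz mu) T].
Proof.
case=> [[nu [Pnu _ nuP]] [nu' [P'nu' _ nu'P]] [eta [eta' [Peta P'eta' e1 edown]]]].
move=> Pmu P'mu'.
rewrite (GGMS_unique Peta Pmu) in e1 edown; rewrite (GGMS_unique P'eta' P'mu') in e1 edown.
rewrite (GGMS_unique Pnu Pmu) in nuP; rewrite (GGMS_unique P'nu' P'mu') in nu'P.
have [[mupW _] [mu'pW _]] := (Pmu, P'mu').
split=> // [w /lweak_lt_srefl|T]; first exact: edown.
rewrite (bz_lower mupW mu'pW nuP nu'P e1 edown); congr (lower _ (_ - _ - 1) _ _).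
  by rewrite BZ_bz //; congr (bz mu _); apply/setP=> a; rewrite !inE wperm1 perm1.
rewrite BZ_bz //; congr (bz mu _); apply/setP=> a.
by rewrite !inE wperm_refl.
Qed.

End Lowering.

(** * Bounds on the lowered data *)

Section LowerTheory.
Variables (R : realType) (l : nat).
Implicit Types (i : 'I_l) (a b : 'I_l.+1) (S T : {set 'I_l.+1}).
Implicit Types (M N : {set 'I_l.+1} -> R) (c : R) (h : 'cV[R]_l).

Lemma lower_le i c M T : lower i c M T <= M T.
Proof. by rewrite /lower; case: ifP => // _; rewrite ge_min lexx. Qed.

Lemma eq_lower i c M N : M =1 N -> lower i c M =1 lower i c N.
Proof. by move=> MN T; rewrite /lower !MN. Qed.

Lemma lower_comm (i j : 'I_l) c M T : (i.+1 < j)%N ->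
  lower i c (lower j c M) T = lower j c (lower i c M) T.
Proof.
move=> ij; rewrite /lower !inE !(adj_far ij).
have -> : swap j (swap i T) = swap i (swap j T).
  apply/setP=> a; rewrite !inE; congr (_ \in T); apply: ord_inj.
  by rewrite !adjE; do ![case: ifP => /=]; lia.
case: ifP => // _; case: ifP => // _.
by rewrite !addr_minl minACA.
Qed.

Lemma pairing_wt_coroot T i :
  pairing (wt R T) (coroot R i) = (lo i \in T)%:R - (hi i \in T)%:R.
Proof. by rewrite /pairing /coroot -colE !mxE wtE. Qed.

Lemma wt_swap T i : lo i \in T -> hi i \notin T ->
  wt R (swap i T) = wt R T - sroot R (typeA l) i.
Proof.
move=> loT hiT; rewrite -(setD1K loT) swapU ?inE ?eqxx ?(negPf hiT) ?andbF //.
rewrite /wt !big_setU1 ?inE ?eqxx ?(negPf hiT) ?andbF //=.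
by rewrite sroot_eps opprB [RHS]addrC addrA subrK.
Qed.

Lemma shiftE i c h : srefl R (typeA l) i *m h + c *: coroot R i =
  h + (c - pairing (sroot R (typeA l) i) h) *: coroot R i.
Proof. by rewrite refl_mxE scalerBl addrA addrAC. Qed.

Lemma pairing_wt_shift T i c h :
  pairing (wt R T) (srefl R (typeA l) i *m h + c *: coroot R i) =
  pairing (wt R T) h + (c - pairing (sroot R (typeA l) i) h) *
    ((lo i \in T)%:R - (hi i \in T)%:R).
Proof. by rewrite shiftE pairingDr pairingZr pairing_wt_coroot. Qed.

(** If the pairing of T with h_i is 1, the point s_i h + c h_i meets the second
    term of the minimum; otherwise it is obtained from h by moving along a
    nonnegative multiple of - h_i, which does not lower the value of [wt T]. *)
Lemma lower_shift i c M h : (forall T, M T <= pairing (wt R T) h) ->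
  c <= pairing (sroot R (typeA l) i) h ->
  forall T, lower i c M T <=
    pairing (wt R T) (srefl R (typeA l) i *m h + c *: coroot R i).
Proof.
move=> Mh cd T; rewrite pairing_wt_shift /lower.
have MT := Mh T; have MsT := Mh (swap i T).
case: ifPn => [/andP[loT hiT]|].
  move: MsT; rewrite wt_swap // pairingBl loT (negPf hiT) => MsT.
  by rewrite ge_min; apply/orP; right; rewrite /=; lra.
by case: (lo i \in T); case: (hi i \in T) => //= _; nra.
Qed.

End LowerTheory.

(** * The diagram automorphism *)

Section DiagramAut.
Variables (R : realType) (n : nat) (ev : bool).
Local Notation l := (ell n ev).
Local Notation W := (weyl R (typeA l)).
Local Notation s_ := (srefl R (typeA l)).
Implicit Types (i : 'I_l) (a b : 'I_l.+1) (S T : {set 'I_l.+1}) (w : W).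
Implicit Types (mu : gfamily R (typeA l)) (h : 'cV[R]_l) (c : R).
Implicit Types (M : {set 'I_l.+1} -> R).

(** The action of the diagram automorphism on chamber weights; it takes
    complements since [eps a] is mapped to minus the reversed coordinate. *)
Definition dual T := [set a : 'I_l.+1 | rev_ord a \notin T].

Lemma dualK T : dual (dual T) = T.
Proof. by apply/setP=> a; rewrite !inE rev_ordK negbK. Qed.

Lemma rev_lo i : rev_ord (lo i) = hi (rev_ord i).
Proof. by apply: ord_inj => /=; have := ltn_ord i; lia. Qed.

Lemma rev_hi i : rev_ord (hi i) = lo (rev_ord i).
Proof. by apply: ord_inj => /=; have := ltn_ord i; lia. Qed.

Lemma rev_adj i a : rev_ord (adj i a) = adj (rev_ord i) (rev_ord a).
Proof.
rewrite /adj -rev_lo -rev_hi [tperm _ _ in RHS]tpermC.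
case: tpermP => [->|->|/eqP aL /eqP aR]; rewrite ?tpermL ?tpermR //.
by rewrite tpermD // (inj_eq rev_ord_inj) eq_sym.
Qed.

Lemma pairing_omegah T h : pairing (wt R T) (omegah h) = pairing (wt R (dual T)) h.
Proof.
rewrite /pairing mxE [RHS]mxE (reindex_inj rev_ord_inj) /=.
apply: eq_bigr => p _; rewrite [omegah _ _ _]mxE rev_ordK; congr (_ * _).
rewrite !wtE !inE rev_lo rev_hi.
by case: (_ \in T); case: (_ \in T); rewrite /= ?subrr ?subr0 ?sub0r.
Qed.

Lemma sroot_omegah i h :
  pairing (sroot R (typeA l) i) (omegah h) = pairing (sroot R (typeA l) (rev_ord i)) h.
Proof.
rewrite /pairing mxE [RHS]mxE (reindex_inj rev_ord_inj) /=.
apply: eq_bigr => p _; rewrite [omegah _ _ _]mxE rev_ordK; congr (_ * _).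
by rewrite mxE [RHS]mxE -(typeA_rev p (rev_ord i)) rev_ordK.
Qed.

Lemma eps_rev a (p : 'I_l) : eps R (rev_ord a) 0 p = - eps R a 0 (rev_ord p).
Proof.
rewrite !mxE /= opprB; have := ltn_ord a; have := ltn_ord p => ? ?.
by congr (_ %:R - _%:R); congr nat_of_bool; lia.
Qed.

Lemma wperm_omegaW w a : wperm (omegaW w) a = rev_ord (wperm w (rev_ord a)).
Proof.
apply: (@eps_inj R); rewrite -eps_wperm; apply/rowP=> p; rewrite eps_rev.
rewrite -eps_wperm !mxE (reindex_inj rev_ord_inj) /= -sumrN.
apply: eq_bigr => q _; rewrite -mulNr; congr (_ * _); last by rewrite mxE rev_ordK.
by rewrite eps_rev opprK.
Qed.

Lemma descent_omegaW w i : descent (omegaW w) i = descent w (rev_ord i).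
Proof.
rewrite /descent !wperm_omegaW rev_lo rev_hi /=.
have := ltn_ord (wperm w (lo (rev_ord i))).
by have := ltn_ord (wperm w (hi (rev_ord i))); lia.
Qed.

Lemma iset_omegaW w i : iset (omegaW w) (rev_ord i) = dual (iset w i).
Proof.
apply/setP=> a; rewrite !inE wperm_omegaW /=.
by have := ltn_ord i; have := ltn_ord (wperm w (rev_ord a)); lia.
Qed.

Lemma omegaW1 : omegaW (1%g : W) = 1%g.
Proof. by apply: wperm_inj; apply/permP=> a; rewrite wperm_omegaW wperm1 !perm1 rev_ordK. Qed.

Lemma Vomega_fix mu w : Vomega mu -> omegah (mu (omegaW w)) = mu w.
Proof. by case=> _ /(congr1 (fun f => f w)). Qed.

Lemma BZ_omegaW mu w i : Vomega mu -> BZ mu (omegaW w) (rev_ord i) = BZ mu w i.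
Proof.
by move=> muV; rewrite !BZE iset_omegaW -pairing_omegah Vomega_fix.
Qed.

Lemma bz_dual mu T : Vomega mu -> bz mu (dual T) = bz mu T.
Proof.
move=> muV; have mupW := muV.1.
have le S : bz mu (dual S) <= bz mu S.
  have [w wS] := initial_ex R S.
  by rewrite (bz_initial mupW wS) -Vomega_fix // pairing_omegah bz_le.
by apply/eqP; rewrite eq_le le -{1}[T]dualK le.
Qed.

(** A pseudo-Weyl family is determined by its BZ data, so symmetry can be tested
    on the latter. *)
Lemma Vomega_bz mu : pseudoWeyl mu -> (forall T, bz mu (dual T) = bz mu T) ->
  Vomega mu.
Proof.
move=> mupW mud; split=> //; apply: funext => w.
have E i : pairing (wt R (iset w i)) (omegah (mu (omegaW w))) =
    pairing (wt R (iset w i)) (mu w).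
  by rewrite pairing_omegah -iset_omegaW -!BZE !BZ_bz // iset_omegaW.
by apply: (@weyl_ge_anti _ _ w); apply/weyl_geE => i; rewrite E.
Qed.

Lemma lower_dual i c M T :
  lower i c M (dual T) = lower (rev_ord i) c (fun S => M (dual S)) T.
Proof.
rewrite /lower !inE rev_lo rev_hi negbK andbC; case: ifP => // _.
congr (Num.min _ (M _ + _)); apply/setP=> a.
by rewrite !inE rev_adj.
Qed.

(** * The folded lowering operator *)

Section FoldedLowering.
Variables (k : 'I_l) (P Q P' : set 'cV[R]_l).
Variables (mu mu' : gfamily R (typeA l)).
Local Notation k' := (rev_ord k).
Hypothesis kk' : (k.+1 < k')%N.
Hypotheses (PQ : kashiwara (typeA l) k' P Q) (QP' : kashiwara (typeA l) k Q P').
Hypotheses (Pmu : GGMS P mu) (P'mu' : GGMS P' mu') (muV : Vomega mu).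

Let c := BZ mu 1%g k - BZ mu (s_ k) k - 1.
Let M := bz mu.
Let M' := bz mu'.
Let mupW : pseudoWeyl mu := Pmu.1.
Let mu'pW : pseudoWeyl mu' := P'mu'.1.

(** The two operators have the same constant: for the first one by symmetry, for
    the second one because the sets [1, k] and s_k [1, k] contain neither of the
    letters exchanged by the other reflection, so that the first operator does
    not affect them. *)
Lemma lower_pair : [/\ mu' 1%g = mu 1%g - (coroot R k + coroot R k'),
  forall w, descent w k -> descent w k' -> mu' w = mu w &
  forall T, M' T = lower k c (lower k' c M) T].
Proof.
have [nu Qnu] : exists nu : gfamily R (typeA l), GGMS Q nu.
  by case: PQ => _ [nu [Qnu _ _]] _; exists nu.
have [nu1 nudown nuM] := kashiwara_bz PQ Pmu Qnu.
have [mu'1 mu'down mu'M] := kashiwara_bz QP' Qnu P'mu'.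
split=> [|w dk dk'|T]; first by rewrite mu'1 nu1 opprD addrAC addrA.
  by rewrite mu'down ?nudown.
rewrite /M' mu'M.
have c' : BZ mu 1%g k' - BZ mu (s_ k') k' - 1 = c.
  by rewrite -omegaW_refl -{1}omegaW1 !BZ_omegaW.
have far w : wperm w (lo k') = lo k' -> BZ nu w k = BZ mu w k.
  move=> wk'; have nupW := Qnu.1; rewrite !BZ_bz // nuM /lower inE wk' /=.
  by rewrite leqNgt (ltn_trans _ kk').
rewrite !far ?wperm1 ?perm1 ?wperm_refl ?(adj_far kk') // -/c.
by apply: eq_lower => S; rewrite nuM c'.
Qed.

(** The automorphism exchanges the two commuting operators. *)
Lemma lowered_Vomega : Vomega mu'.
Proof.
have [_ _ M'E] := lower_pair; apply: Vomega_bz => // T.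
rewrite -/M' !M'E lower_dual lower_comm //; apply: eq_lower => S.
rewrite lower_dual rev_ordK; apply: eq_lower => U; exact: bz_dual.
Qed.

Let sigma h := s_ k *m h + c *: coroot R k.
Let tau h := s_ k' *m h + c *: coroot R k'.
Let alpha i h := pairing (sroot R (typeA l) i) h.

(** The simple root alpha_k vanishes on the coroot of omega k. *)
Lemma alpha_tau h : pairing (sroot R (typeA l) k) (tau h) =
  pairing (sroot R (typeA l) k) h.
Proof.
have k'k0 : typeA l k' k = 0.
  rewrite !mxE -!val_eqE; have := kk'; rewrite /=.
  by do ![case: eqP => //=]; lia.
by rewrite /tau shiftE pairingDr pairingZr pairing_sroot_coroot k'k0 mulr0 addr0.
Qed.

Lemma mu_le w T : M T <= pairing (wt R T) (mu w).
Proof. exact: bz_le. Qed.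

Lemma lowered_comm T : M' T = lower k' c (lower k c M) T.
Proof. by have [_ _ ->] := lower_pair; exact: lower_comm. Qed.

Lemma vertex_in_lowered w : polytope mu' (mu w).
Proof.
apply: polytope_bz => // T; have [_ _ M'E] := lower_pair; rewrite -/M' M'E.
by do 2![apply: le_trans (lower_le _ _ _ _) _]; exact: mu_le.
Qed.

Lemma sigma_in_lowered w : c <= alpha k (mu w) -> polytope mu' (sigma (mu w)).
Proof.
move=> cw; apply: polytope_bz => // T; have [_ _ M'E] := lower_pair.
rewrite -/M' M'E; apply: lower_shift => // S.
by apply: le_trans (lower_le _ _ _ _) _; exact: mu_le.
Qed.

Lemma tau_in_lowered w : c <= alpha k' (mu w) -> polytope mu' (tau (mu w)).
Proof.
move=> cw; apply: polytope_bz => // T; rewrite -/M' lowered_comm; apply: lower_shift => // S.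
by apply: le_trans (lower_le _ _ _ _) _; exact: mu_le.
Qed.

Lemma alpha_rev w : Womega w -> alpha k' (mu w) = alpha k (mu w).
Proof.
by move=> ww; rewrite /alpha -sroot_omegah -{1}ww Vomega_fix.
Qed.

Lemma sigmatau_in_lowered w : Womega w -> c <= alpha k (mu w) ->
  polytope mu' (sigma (tau (mu w))).
Proof.
move=> ww cw; apply: polytope_bz => // T; have [_ _ M'E] := lower_pair.
rewrite -/M' M'E; apply: lower_shift => [S|].
  apply: lower_shift => [U|]; [exact: mu_le | by rewrite -/(alpha _ _) alpha_rev].
by rewrite alpha_tau.
Qed.

Lemma descent_rev w : Womega w -> descent w k' = descent w k.
Proof. by move=> ww; rewrite -descent_omegaW ww. Qed.

Lemma iset_srefl w i j : iset (s_ i * w)%g j = swap i (iset w j).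
Proof. by apply/setP=> a; rewrite !inE wpermM wperm_refl permM. Qed.

Lemma Womega_srefl2 w : Womega w -> Womega (s_ k * s_ k' * w)%g.
Proof.
move=> ww; rewrite /Womega /= !omegaWM !omegaW_refl rev_ordK ww.
by rewrite (srefl_comm R kk').
Qed.

Section Minimality.
Variable mu2 : gfamily R (typeA l).
Hypothesis mu2_down :
  forall w, Womega w -> lweak_lt (s_ k * s_ k' * w)%g w -> mu2 w = mu w.
Hypothesis mu2_up :
  forall w, Womega w -> lweak_lt w (s_ k * s_ k' * w)%g -> Ptilde mu2 (mu w).
Hypothesis mu2_sigma :
  forall w, lweak_lt (s_ k * w)%g w -> c <= alpha k (mu w) -> Ptilde mu2 (sigma (mu w)).
Hypothesis mu2_tau :
  forall w, lweak_lt (s_ k' * w)%g w -> c <= alpha k' (mu w) -> Ptilde mu2 (tau (mu w)).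
Hypothesis mu2_sigmatau :
  forall w, Womega w -> lweak_lt (s_ k * s_ k' * w)%g w -> c <= alpha k (mu w) ->
    Ptilde mu2 (sigma (tau (mu w))).

Lemma Ptilde_wt w i h : Womega w -> Ptilde mu2 h ->
  pairing (wt R (iset w i)) (mu2 w) <= pairing (wt R (iset w i)) h.
Proof. by move=> ww /(_ w ww)/weyl_geE. Qed.

(** For w fixed by omega, the descents k and omega k come together.  If they are
    present, the vertices of the three families agree at w.  Otherwise mu w lies
    in the polytope of mu2, which bounds the term M_(w Lambda_i) of the minimum;
    any other term is the value at a shifted vertex that lies in that polytope,
    or else it exceeds M_(w Lambda_i). *)
Lemma Ptilde_mono : (Ptilde mu' `<=` Ptilde mu2)%classic.
Proof.
move=> h Ph w ww; apply/weyl_geE=> i; set T := iset w i.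
apply: le_trans (_ : _ <= pairing (wt R T) (mu' w)) _; last first.
  by move/weyl_geE: (Ph w ww); apply.
have [_ mu'_down M'E] := lower_pair.
have [dw|dw] := boolP (descent w k).
  have dw' : descent w k' by rewrite descent_rev.
  by rewrite mu'_down // mu2_down //; apply/(lweak_lt_srefl2 kk').
have dw' : ~~ descent w k' by rewrite descent_rev.
rewrite -(bz_initial mu'pW (initial_iset w i)) -/M' M'E.
have le_M : pairing (wt R T) (mu2 w) <= M T.
  rewrite /M (bz_initial mupW (initial_iset w i)).
  by apply: Ptilde_wt => //; apply: mu2_up => //; exact: lweak_gt_srefl2.
have MT v : M T <= pairing (wt R T) (mu v) by exact: mu_le.
have Mv v S : iset v i = S -> M S = pairing (wt R S) (mu v).
  by move=> <-; exact: (bz_initial mupW (initial_iset v i)).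
have le_swap i0 : ~~ descent w i0 ->
    (forall v, lweak_lt (s_ i0 * v)%g v -> c <= alpha i0 (mu v) ->
       Ptilde mu2 (s_ i0 *m mu v + c *: coroot R i0)) ->
    lo i0 \in T -> hi i0 \notin T ->
    pairing (wt R T) (mu2 w) <= M (swap i0 T) + c.
  move=> dw0 shift_in loT hiT.
  rewrite (Mv (s_ i0 * w)%g) ?iset_srefl // wt_swap // pairingBl.
  set v := (s_ i0 * w)%g; have [cv|cv] := leP c (alpha i0 (mu v)).
    have vdown : lweak_lt (s_ i0 * v)%g v by apply/lweak_lt_srefl; rewrite descent_srefl.
    have := Ptilde_wt i ww (shift_in v vdown cv); rewrite -/T pairing_wt_shift.
    rewrite loT (negPf hiT) /alpha /=; lra.
  (* The shifted point is not available, but the term exceeds M T. *)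
  have := MT v; move: le_M cv; rewrite /alpha; lra.
have le_swap2 : lo k \in T -> hi k \notin T -> lo k' \in T -> hi k' \notin T ->
    pairing (wt R T) (mu2 w) <= M (swap k' (swap k T)) + c + c.
  move=> loT hiT loT' hiT'.
  set v := (s_ k * s_ k' * w)%g; have vv : Womega v by exact: Womega_srefl2.
  have vT : iset v i = swap k' (swap k T).
    by rewrite /v (srefl_comm R kk') -mulgA !iset_srefl.
  have loT'' : lo k' \in swap k T by rewrite in_set (adj_far kk').
  have hiT'' : hi k' \notin swap k T by rewrite in_set (adj_far kk').
  rewrite (Mv v) // !wt_swap // !pairingBl.
  (* By symmetry, both roots take the same value at mu v: one test is enough. *)
  rewrite -/(alpha k (mu v)) -/(alpha k' (mu v)) alpha_rev //.
  have [cv|cv] := leP c (alpha k (mu v)).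
    have vdown : lweak_lt (s_ k * s_ k' * v)%g v.
      apply/(lweak_lt_srefl2 kk'); have [-> ->] := descent_srefl2 kk' w; by rewrite dw dw'.
    have := Ptilde_wt i ww (mu2_sigmatau vv vdown cv); rewrite -/T /sigma.
    rewrite pairing_wt_shift alpha_tau /tau pairing_wt_shift.
    rewrite -/(alpha k (mu v)) -/(alpha k' (mu v)) alpha_rev //.
    rewrite loT (negPf hiT) loT' (negPf hiT') /=; lra.
  have := MT v; move: le_M cv; lra.
have swapE a : (a \in swap k T) = (adj k a \in T) by rewrite in_set.
rewrite -/T /lower !swapE !(adj_far kk').
case: ifPn => [/andP[loT hiT]|_]; case: ifPn => [/andP[loT' hiT']|_] //.
- by rewrite addr_minl !le_min le_M ?(le_swap _ dw mu2_sigma) ?(le_swap _ dw' mu2_tau) ?le_swap2.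
- by rewrite !le_min le_M (le_swap _ dw mu2_sigma).
by rewrite !le_min le_M (le_swap _ dw' mu2_tau).
Qed.

End Minimality.

End FoldedLowering.

End DiagramAut.

Local Open Scope classical_set_scope.

Theorem theorem3p2p3 (R : realType) (n : nat) (ev : bool) (n_ge2 : (2 <= n)%N)
    (Theta : weyl R (typeBC n ev) -> weyl R (typeA (ell n ev)))
    (ThetaP : is_Theta Theta)
    (j : 'I_n) (j_lt : (j.+1 < n)%N)
    (hatP : set 'cV[R]_n) (hatP_MV : MV (typeBC n ev) hatP)
    (P : set 'cV[R]_(ell n ev)) (P_MV : MVomega P) (PhiP : Phi Theta P hatP)
    (P' : set 'cV[R]_(ell n ev)) (P'E : kashiwara_omega j P P')
    (mu mu' : gfamily R (typeA (ell n ev))) (muP : GGMS P mu)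
    (mu'P : GGMS P' mu') :
  [/\ Vomega mu', conditions_i_v j mu mu' &
      forall mu2 : gfamily R (typeA (ell n ev)),
        Vomega mu2 -> conditions_i_v j mu mu2 -> Ptilde mu' `<=` Ptilde mu2].
Proof.
have muV : Vomega mu.
  by case: P_MV => _ [nu Pnu nuV]; rewrite (GGMS_unique muP Pnu).
have kk' : ((emb ev j).+1 < rev_ord (emb ev j))%N.
  by rewrite /= /ell; case: (ev); lia.
move: P'E; rewrite /kashiwara_omega j_lt => -[Q [PQ QP']].
have [mu'1 mu'down _] := lower_pair kk' PQ QP' muP mu'P muV.
have inP g : polytope mu' g -> Ptilde mu' g by move=> Pg w _; exact: Pg.
split; first exact: lowered_Vomega PQ QP' muP mu'P muV.
- rewrite /conditions_i_v /refl_omega /coroot_omega j_lt; split=> //.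
  + by move=> w _ /(lweak_lt_srefl2 kk')[]; exact: mu'down.
  + by move=> w _ _; apply: inP; exact: vertex_in_lowered PQ QP' muP mu'P muV _.
  + split=> w _ cw; apply: inP.
      exact: sigma_in_lowered PQ QP' muP mu'P muV _ cw.
    exact: tau_in_lowered PQ QP' muP mu'P muV _ cw.
  + by move=> w ww _ cw; apply: inP; exact: sigmatau_in_lowered PQ QP' muP mu'P muV _ ww cw.
- move=> mu2 _; rewrite /conditions_i_v /refl_omega j_lt => -[down _ up [sig ta] st].
  exact: (Ptilde_mono kk' PQ QP' muP mu'P muV down up sig ta st).
Qed.
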